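(* Let $(X,d,\mathfrak m)$ be a metric measure space. Let $f,g:X\to\overline{\mathbb R}$ be Borel functions, Sobolev along almost every curve, such that both $|\nabla f|_w$ and $|\nabla g|_w$ belong to $L^2(X,\mathfrak m)$, and let $\pi$ be a test plan. For $\gamma\in AC^2([0,1];X)$ and $t\in(0,1]$ set $E_t(\gamma):=\sqrt{t\int_0^t|\dot\gamma_s|^2\,ds}$. Assume that $$\lim_{t\downarrow0}\frac{g(\gamma_0)-g(\gamma_t)}{E_t(\gamma)}=\lim_{t\downarrow0}\frac{E_t(\gamma)}t=|\nabla g|_w(\gamma_0)\qquad\text{in }L^2\big(AC^2([0,1];X),\pi\big).$$ Then $$\liminf_{t\downarrow0}\int\frac{f(\gamma_t)-f(\gamma_0)}t\,d\pi(\gamma)\ \ge\ \limsup_{\varepsilon\downarrow0}\int\frac{|\nabla g|_w^2(\gamma_0)-|\nabla(g+\varepsilon f)|_w^2(\gamma_0)}{2\varepsilon}\,d\pi(\gamma).$$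
   Context: A metric measure space $(X,d,\mathfrak m)$ is a complete separable metric space with a Borel probability measure $\mathfrak m$ with finite second moment. $AC^2([0,1];X)$ is the set of absolutely continuous curves with metric speed $|\dot\gamma|\in L^2(0,1)$; $e_t(\gamma)=\gamma_t$. A test plan is a Borel probability measure $\pi$ on $AC^2([0,1];X)$ such that for some $C>0$, $(e_t)_\sharp\pi\le C\mathfrak m$ for all $t\in[0,1]$. A property holds for a.e. curve if it fails only on a subset of a Borel set that is $\pi$-null for all test plans. $f:X\to\overline{\mathbb R}$ is Sobolev along a.e. curve if for a.e. curve $\gamma$, $f\circ\gamma$ coincides a.e. in $[0,1]$ and at $0,1$ with an absolutely continuous function; then $|\nabla f|_w$ is the $\mathfrak m$-a.e. minimal $\mathfrak m$-measurable $G:X\to[0,\infty]$ with $|f(\gamma_1)-f(\gamma_0)|\le\int_0^1G(\gamma_t)|\dot\gamma_t|dt$ for a.e. curve. Convention: ratios with denominator $E_t(\gamma)$ are set equal to $0$ when $E_t(\gamma)=0$ (i.e. $\gamma$ is constant on $[0,t]$). *)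

(* Defs.v *)
From HB Require Import structures.
From mathcomp Require Import all_boot all_order all_algebra.
From mathcomp Require Import all_classical all_reals all_analysis.
From mathcomp Require Import measurable_realfun.

Set Implicit Arguments.
Unset Strict Implicit.
Unset Printing Implicit Defensive.

Import Order.TTheory GRing.Theory Num.Theory.
Import numFieldNormedType.Exports.

Local Open Scope classical_set_scope.
Local Open Scope ring_scope.

(* Pointedness comes with [Complete]; it excludes only the empty space, which
   carries no probability measure. *)
#[short(type="completeMetricType")]
HB.structure Definition CompleteMetric (R : numDomainType) :=
  {T of Metric R T & Complete T}.

Definition separable (T : topologicalType) :=
  exists2 D : set T, countable D & dense D.

Notation borel T := (g_sigma_algebraType (@open T)).

Section absolute_continuity.
Context {R : realType} {T : metricType R}.

Definition abs_cont (u : R -> T) := forall e : R, 0 < e ->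
  exists2 d : R, 0 < d &
    forall (n : nat) (a b : 'I_n -> R),
      (forall i, 0 <= a i /\ a i <= b i /\ b i <= 1) ->
      trivIset setT (fun i => `]a i, b i[%classic) ->
      \sum_(i < n) (b i - a i) < d ->
      \sum_(i < n) mdist (u (a i)) (u (b i)) < e.

(* When the limit does not exist, [lim] returns [point = 0]; for an absolutely
   continuous curve this happens only on a null set of times. *)
Definition metric_speed (u : R -> T) (t : R) : R :=
  lim (mdist (u (t + h)) (u t) / `|h| @[h --> (0 : R)^']).

End absolute_continuity.

Section curves.
Context {R : realType} {X : completeMetricType R}.
Local Notation leb := (@lebesgue_measure R).

(* A curve on [0,1] is encoded as its extension to R that is constant on
   ]-oo,0] and on [1,+oo[; this makes the encoding one-to-one. *)
Definition ac2_curves : set (R -> X) := [set u |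
  [/\ forall t, u t = u (Num.max 0 (Num.min t 1)),
      abs_cont u &
      (\int[leb]_(t in `[0%R, 1%R]) ((metric_speed u t) ^+ 2)%:E < +oo)%E]].

Definition AC2 : Type := ac2_curves.

HB.instance Definition _ := Choice.on AC2.

Definition ev (t : R) (c : AC2) : X := val c t.

Lemma ac2_curves_cst (x : X) : ac2_curves (cst x).
Proof.
have mxx : mdist x x = 0 by exact: mdistxx.
split=> [//|e e0|].
- exists 1 => // n a b _ _ _.
  by rewrite big1// => i _; rewrite /cst/= mxx.
- under eq_integral => t _.
    rewrite (_ : metric_speed (cst x) t = 0).
      rewrite expr0n/=.
    over.
    rewrite /metric_speed /cst mxx; apply/cvg_lim => //.
    by under eq_fun do rewrite mul0r; exact: cvg_cst.
  by rewrite integral0.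
Qed.

HB.instance Definition _ :=
  isPointed.Build AC2 (SigSub (mem_set (ac2_curves_cst point))).

(* The topology of uniform convergence on [0,1], i.e. that of the distance
   sup_(t in [0,1]) d(c_t, c'_t). *)
HB.instance Definition _ := Topological.copy AC2
  (initial_topology (val : AC2 -> {uniform` `[(0 : R), 1]%classic -> X})).

End curves.
Arguments AC2 {R} X.

Section weak_gradients.
Context {R : realType} {X : completeMetricType R}.
Local Notation leb := (@lebesgue_measure R).
Local Open Scope ereal_scope.

Definition finite_second_moment (m : probability (borel X) R) :=
  exists x0 : X, \int[m]_x ((mdist x x0) ^+ 2)%:E < +oo.

Definition test_plan (m : probability (borel X) R)
    (pi : probability (borel (AC2 X)) R) :=
  exists2 C : R, (0 < C)%R &
    forall t : R, (0 <= t <= 1)%R -> forall A : set (borel X), measurable A ->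
      pushforward pi (ev t : borel (AC2 X) -> borel X) A <= C%:E * m A.

Definition ae_curve (m : probability (borel X) R) (P : AC2 X -> Prop) :=
  exists N : set (borel (AC2 X)),
    [/\ measurable N,
        forall pi : probability (borel (AC2 X)) R, test_plan m pi -> pi N = 0 &
        forall c, ~ P c -> N c].

Definition sobolev_ae_curve (m : probability (borel X) R) (f : X -> \bar R) :=
  ae_curve m (fun c => exists h : R -> R,
    [/\ abs_cont (h : R -> R^o),
        {ae leb, forall t, t \in `[0%R, 1%R] -> f (ev t c) = (h t)%:E},
        f (ev 0 c) = (h 0%R)%:E &
        f (ev 1 c) = (h 1%R)%:E]).

(* Measurability with respect to the completion of the Borel sigma-algebra. The
   library's integral of a nonnegative function is the supremum of the integrals
   of the simple functions below it, so over the Borel sigma-algebra it still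
   gives the right value for such functions. *)
Definition m_measurable (m : probability (borel X) R) (G : X -> \bar R) :=
  measurable_fun setT
    (G : g_sigma_algebraType (completed_algebra_gen m) -> \bar R).

(* Finiteness of the line integral is part of the notion: without it there would
   be no least G. E.g. on [0,1], if phi is finite with infinite integral on every
   interval, then c * phi would be admissible for every f and every c > 0. *)
Definition weak_upper_gradient (m : probability (borel X) R)
    (f G : X -> \bar R) :=
  [/\ m_measurable m G,
      forall x, 0 <= G x &
      ae_curve m (fun c =>
        let I := \int[leb]_(t in `[0%R, 1%R])
                   (G (ev t c) * (metric_speed (val c) t)%:E) in
        `|f (ev 1 c) - f (ev 0 c)| <= I /\ I < +oo)].

Definition minimal_weak_upper_gradient (m : probability (borel X) R)
    (f G : X -> \bar R) :=
  weak_upper_gradient m f G /\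
  forall G', weak_upper_gradient m f G' ->
    {ae m, forall x : borel X, G x <= G' x}.

(* A representative of |grad f|_w, which is unique up to m-null sets; it is +oo
   (hence not in L^2) when f has no minimal weak upper gradient. *)
Definition wgrad (m : probability (borel X) R) (f : X -> \bar R) : X -> \bar R :=
  xget (cst +oo) [set G | minimal_weak_upper_gradient m f G].

(* As [0^-1 = 0], a ratio over [Et t c] is 0 when [Et t c = 0]. *)
Definition Et (t : R) (c : AC2 X) : R :=
  Num.sqrt (t * \int[leb]_(s in `[0%R, t]) (metric_speed (val c) s) ^+ 2)%R.

End weak_gradients.

(* Main.v *)
Require Import Defs.
From HB Require Import structures.
From mathcomp Require Import all_boot all_order all_algebra.
From mathcomp Require Import all_classical all_reals all_analysis.
From mathcomp Require Import measurable_realfun.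
Import Order.TTheory GRing.Theory Num.Theory.
Import numFieldNormedType.Exports.
Local Open Scope classical_set_scope.
Local Open Scope ring_scope.
Local Open Scope ereal_scope.
From mathcomp Require Import lra ring.

Set Implicit Arguments.
Unset Strict Implicit.

(** Horizontal and vertical derivatives.

    Let [h] be Sobolev along almost every curve. The defining inequality of a
    weak upper gradient and Cauchy-Schwarz along a curve [c] give
    [[
      |h(c_t) - h(c_0)|^2 <= E_t(c)^2 * int_0^1 |grad h|_w^2(c_(t s)) ds,
    ]]
    so that the quotient [H_t = (h(c_0) - h(c_t)) / E_t] satisfies
    [[
      int H_t^2 dpi <= int_0^1 int |grad h|_w^2(c_(t s)) dpi ds.
    ]]
    As [t] decreases to [0] the right-hand side tends to
    [int |grad h|_w^2(c_0) dpi]: curves are continuous, and the bounded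
    compression of [pi] turns continuity in time for continuous functions into
    continuity in time for all [m]-integrable ones. Let [F_t] and [G_t] be the
    quotients of [f] and [g]. For [h = g + eps f] the quotient is
    [G_t + eps F_t], hence
    [[
      limsup int (G_t + eps F_t)^2 dpi <= int |grad (g + eps f)|_w^2(c_0) dpi,
    ]]
    while by hypothesis [G_t] tends to [|grad g|_w(c_0)] in [L2(pi)]. Expanding
    the square bounds [- int F_t G_t dpi] from below by the [eps]-difference
    quotient of the weak gradients, up to a vanishing error. Finally
    [(f(c_t) - f(c_0)) / t = - F_t * (E_t / t)], and [E_t / t] may be replaced
    by [G_t], because both have the same limit in [L2(pi)] and [F_t] is bounded
    there. The resulting inequality holds for each [eps > 0] separately; when
    [g + eps f] has no minimal weak upper gradient, its left-hand side is [-oo].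

    A weak upper gradient only controls the increment of [h] over the whole
    interval [0,1]. The passage to [0,t] rests on the map [restr t], which
    reparametrises [c] restricted to [0,t]: it sends test plans to test plans
    and [Et 1 (restr t c) = Et t c]. Averages over curves and times are
    exchanged by Tonelli's theorem, which requires the position and the metric
    speed to be jointly measurable ([measurable_eval], [measurable_speed]).
    Weak gradients being measurable only for the completion of the Borel
    sigma-algebra, they are replaced by Borel versions ([sq_representative]);
    this does not affect line integrals, because almost every curve spends no
    time in a given null set ([ae_curve_null]).

    The increments are estimated in [weak_upper_gradient_sqr] and
    [quotient_sqr_le], the continuity in time is
    [trace_continuous_integrable], and the expansion of the square is
    [near_polarization]; [first_variation] puts them together. *)

(** * Curves and their topology *)

Section clamp.
Context {R : realType}.
Local Open Scope ring_scope.

Definition clamp (t : R) : R := Num.max 0 (Num.min t 1).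

Lemma clamp_itv (t : R) : 0 <= clamp t <= 1.
Proof. by rewrite /clamp le_max lexx/= ge_max ler01 ge_min lexx orbT. Qed.

Lemma clamp_id (t : R) : 0 <= t <= 1 -> clamp t = t.
Proof. by move=> /andP[t0 t1]; rewrite /clamp min_l// max_r. Qed.

Lemma clamp_lip (s t : R) : `|clamp s - clamp t| <= `|s - t|.
Proof.
wlog st : s t / s <= t.
  move=> H; case/orP: (le_total s t) => [|ts]; first exact: H.
  by rewrite distrC (distrC s); exact: H.
have cE x : clamp x = if x <= 0 then 0 else if x <= 1 then x else 1.
  rewrite /clamp; case: (leP x 1) => x1; first by case: (ltP 0 x).
  by rewrite max_r ?ler01// ifF//; apply/negbTE; rewrite -ltNge; lra.
have cst : clamp s <= clamp t.
  by rewrite !cE; case: (leP s 0); case: (leP t 0) => //; case: (leP s 1);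
    case: (leP t 1); lra.
rewrite distrC (distrC s) !ger0_norm ?subr_ge0//.
by rewrite !cE; case: (leP s 0); case: (leP t 0) => //; case: (leP s 1);
    case: (leP t 1); lra.
Qed.

End clamp.

Section curves.
Context {R : realType} {X : completeMetricType R}.
Implicit Types c : AC2 X.
Local Open Scope ring_scope.

Lemma curveP c : ac2_curves (val c).
Proof. exact: set_mem (valP c). Qed.

Lemma curve_clamp c t : val c t = val c (clamp t).
Proof. by have [h _ _] := curveP c; exact: h. Qed.

Lemma curve_uniform c (e : R) : 0 < e -> exists2 d : R, 0 < d &
  forall s t, `|s - t| < d -> mdist (val c s) (val c t) < e.
Proof.
move=> e0; have [_ /(_ _ e0)[d d0 h] _] := curveP c.
exists d => // s t std.
rewrite curve_clamp (curve_clamp c t).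
have {std} := le_lt_trans (clamp_lip s t) std.
move: (clamp_itv s) (clamp_itv t); move: (clamp s) (clamp t) => {}s {}t.
wlog st : s t / s <= t.
  move=> H s01 t01; case/orP: (le_total s t) => [|ts]; first by move=> *; apply: H.
  by rewrite distrC metric_sym; exact: H.
move=> /andP[s0 s1] /andP[t0 t1]; rewrite distrC ger0_norm ?subr_ge0// => std.
have := h 1%N (fun=> s) (fun=> t).
rewrite !big_ord_recl !big_ord0 !addr0; apply => //.
by apply/trivIsetP => i j _ _; rewrite (ord1 i) (ord1 j) eqxx.
Qed.

Lemma curve_continuous c : continuous (val c : R -> X).
Proof.
move=> t; apply/cvg_ballP => e e0.
have [d d0 h] := curve_uniform c e0.
near=> s; rewrite ballEmdist/=; apply: h.
by near: s; exact: (nbhsx_ballx t d).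
Unshelve. all: by end_near. Qed.

(** Unfolds the initial topology once and for all: continuity of maps on the
    space of curves reduces to uniform estimates over [0,1]. *)
Lemma nbhs_AC2P c (P : set (AC2 X)) : nbhs c P <->
  exists2 e : R, 0 < e & forall c' : AC2 X,
   (forall t, 0 <= t <= 1 -> mdist (val c t) (val c' t) < e) -> P c'.
Proof.
split.
- move=> [Q [] [V oV <-] Vc QP].
  have /uniform_nbhs[E [entE EV]] : nbhs (val c : {uniform` `[(0 : R), 1]%classic -> X}) V.
    exact: open_nbhs_nbhs.
  move: entE; rewrite -entourage_ballE => -[e /= e0 eE].
  exists e => // c' cc'; apply: QP; apply: EV => t t01.
  by apply: eE => /=; rewrite ballEmdist/=; apply: cc'; move: t01; rewrite /= in_itv.
- move=> [e e0 eP].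
  have : nbhs (val c : {uniform` `[(0 : R), 1]%classic -> X})
     [set g | forall t, `[(0:R),1]%classic t -> ball (val c t) e (g t)].
    apply/uniform_nbhs; exists [set xy | ball xy.1 e xy.2]; split => //.
    exact: entourage_ball (PosNum e0).
  move=> /(@initial_continuous (AC2 X) {uniform` `[(0 : R), 1]%classic -> X} val c) H.
  apply: (@filterS _ (nbhs c) _ _ _ _ H) => c' h; apply: eP => t t01.
  suff : ball (val c t) e (val c' t) by rewrite ballEmdist.
  by apply: h; rewrite /= in_itv.
Qed.

Lemma mdist_continuous2 (T : topologicalType) (u v : T -> X) (x : T) :
  {for x, continuous u} -> {for x, continuous v} ->
  {for x, continuous (fun y => mdist (u y) (v y))}.
Proof.
move=> cu cv; apply/cvgrPdist_lt => e e0.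
have e20 : 0 < e / 2 by rewrite divr_gt0.
move/cvg_ballP : cu => /(_ _ e20) cu.
move/cvg_ballP : cv => /(_ _ e20) cv.
near=> y.
have : ball (u x) (e / 2) (u y) by near: y.
rewrite ballEmdist/= => uy.
have : ball (v x) (e / 2) (v y) by near: y.
rewrite ballEmdist/= => vy.
have h1 := metric_triangle (u x) (u y) (v x).
have h2 := metric_triangle (u y) (v y) (v x).
have h3 := metric_triangle (u y) (u x) (v y).
have h4 := metric_triangle (u x) (v x) (v y).
rewrite ltr_norml; rewrite (metric_sym (v y)) in h2.
rewrite (metric_sym (u y) (u x)) in h3.
by apply/andP; split; lra.
Unshelve. all: by end_near. Qed.

Lemma ev_continuous t : continuous (ev t : AC2 X -> X).
Proof.
move=> c; have FF : Filter (nbhs c) by exact: nbhs_filter.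
apply: (cvg_ballP _ _).2 => e e0; apply/nbhs_AC2P; exists e => // c' h.
rewrite ballEmdist/= /ev curve_clamp (curve_clamp c').
by apply: h; exact: clamp_itv.
Qed.

End curves.

(** * Reduction of measurability to real functions and rational points *)

Section borel.
Context {R : realType}.
Local Open Scope ring_scope.

Lemma borel_open (T : ptopologicalType) (U : set T) :
  open U -> measurable (U : set (borel T)).
Proof. by move=> oU; exact: sub_sigma_algebra. Qed.

Lemma continuous_borel (T U : ptopologicalType) (f : T -> U) :
  continuous f -> measurable_fun setT (f : borel T -> borel U).
Proof.
move=> /continuousP cf; apply: (@measurability _ _ (borel T) (borel U) setT f (@open U)) => //.
by move=> _ [V oV <-]; rewrite setTI; apply: borel_open; exact: cf.
Qed.

Lemma continuous_borel_real (T : ptopologicalType) (f : T -> R) :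
  continuous f -> measurable_fun setT (f : borel T -> R).
Proof.
move=> /continuousP cf; apply: (measurability _ (RGenOpens.measurableE R)).
move=> _ [_ [a [b ->] <-]]; rewrite setTI; apply: borel_open.
exact/cf/interval_open.
Qed.

(** The distance to the complement. Through it, testing a map into a metric
    space against open sets amounts to testing real functions. *)
Lemma open_cozero (T : metricType R) (U : set T) : open U ->
  exists2 phi : T -> R, continuous phi & U = [set x | 0 < phi x].
Proof.
move=> oU; have [C0|/set0P[a Ca]] := eqVneq (~` U) set0.
  exists (cst 1); first by move=> x; exact: cvg_cst.
  rewrite -(setCK U) C0 setC0; apply/seteqP; split => // x _ /=; exact: ltr01.
have dfin x : edist_inf (~` U) x \is a fin_num.
  rewrite ge0_fin_numE ?edist_inf_ge0//.
  have da : 0 < mdist x a + 1 by rewrite ltr_wpDl// mdist_ge0.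
  apply: (@le_lt_trans _ _ (edist (x, a))).
    by apply: ereal_inf_lbound; exists a.
  apply: (@le_lt_trans _ _ (mdist x a + 1)%:E); last exact: ltry.
  by apply: edist_fin => //; rewrite ballEmdist/= ltrDl.
exists (fun x => fine (edist_inf (~` U) x)).
  move=> x; apply: fine_cvg; rewrite fineK//; exact: edist_inf_continuous.
apply/seteqP; split => x /=.
- move=> Ux; have : nbhs x U by exact: open_nbhs_nbhs.
  move=> /nbhs_ballP[e /= e0 eU].
  apply: (@lt_le_trans _ _ e) => //; rewrite -lee_fin fineK//.
  apply: le_ereal_inf_tmp => _ [y Uy <-]; rewrite leNgt; apply/negP => xy.
  by apply: Uy; apply: eU; exact: (@edist_lt_ball R T _ (x, y)).
- apply: contraPP => Ux; rewrite edist_inf0//= ltxx; by [].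
Qed.

Lemma rat_dense_nbhs (x : R) (V : set R) : nbhs x V -> exists q : rat, V (ratr q).
Proof.
move=> Vx; have [y [/= Vy [q _ qy]]] : V° `&` [set ratr q | q in [set: rat]] !=set0.
  by apply: dense_rat; [exists x; exact: Vx|exact: open_interior].
by exists q; rewrite qy; exact: interior_subset.
Qed.

(** By continuity in [s], the inequality [phi y s > a] means that a margin
    [1/k] above [a] is kept at all rationals within [1/n] of [s]. The set where
    it holds is thus obtained from countably many measurable rectangles. *)
Lemma measurable_caratheodory d (Y : measurableType d) (phi : Y -> R -> R) :
  (forall s, measurable_fun setT (phi ^~ s)) -> (forall y, continuous (phi y)) ->
  measurable_fun setT (fun p : Y * R => phi p.1 p.2).
Proof.
move=> mphi cphi _; apply: (measurability _ (RGenOInfty.measurableE R)) => //.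
move=> _ [_ [a ->] <-]; rewrite setTI.
pose A k n := ~` \bigcup_(r : rat)
  ([set y | phi y (ratr r) < a + k.+1%:R^-1] `*` [set s : R | `|ratr r - s| < n.+1%:R^-1]).
rewrite [X in measurable X](_ : _ = \bigcup_k \bigcup_n A k n).
  apply: bigcupT_measurable => k; apply: bigcupT_measurable => n.
  apply/measurableC/bigcupT_measurable_rat => r; apply: measurableX.
    rewrite -[X in measurable X]setTI.
    have := mphi (ratr r) measurableT `]-oo, (a + k.+1%:R^-1)[%classic.
    by rewrite setTI; apply; exact: measurable_itv.
  rewrite [X in measurable X](_ : _ = ball (ratr r : R) n.+1%:R^-1) //.
  exact: measurable_ball.
apply/seteqP; split => [[y s]|[y s] [k _ [n _]]] /=.
- rewrite in_itv/= andbT => ay.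
  have d0 : 0 < phi y s - a by rewrite subr_gt0.
  have d20 : 0 < (phi y s - a) / 2 by rewrite divr_gt0.
  near \oo => k.
  have kd : k.+1%:R^-1 < (phi y s - a) / 2 by near: k; exact: near_infty_natSinv_lt (PosNum d20).
  have /cvgrPdist_lt/(_ _ d20)/nbhs_ballP[e /= e0 he] := cphi y s.
  near \oo => n.
  have ne : n.+1%:R^-1 < e by near: n; exact: near_infty_natSinv_lt (PosNum e0).
  exists k => //; exists n => //= -[r _ [/= h1 h2]].
  have := he (ratr r); rewrite /ball/= distrC => /(_ (lt_trans h2 ne)).
  rewrite ltr_norml => /andP[_].
  by move: kd h1; move: (k.+1%:R^-1) => x; lra.
- move=> h; rewrite in_itv/= andbT ltNge; apply/negP => ya; apply: h.
  have k0 : 0 < k.+1%:R^-1 :> R by rewrite invr_gt0.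
  have n0 : 0 < n.+1%:R^-1 :> R by rewrite invr_gt0.
  have /cvgrPdist_lt/(_ _ k0) h1 := cphi y s.
  have h2 := nbhsx_ballx s _ n0.
  have [q [/= q1 q2]] := rat_dense_nbhs (filterI h1 h2).
  exists q => //=; split => /=; last by rewrite distrC.
  by move: q1; rewrite ltr_norml => /andP[]; move: (k.+1%:R^-1) => x; lra.
Unshelve. all: by end_near. Qed.

End borel.

(** * Joint measurability of the position *)

Section evaluation.
Context {R : realType} {X : completeMetricType R}.
Local Open Scope ring_scope.

Lemma measurable_ev (t : R) :
  measurable_fun setT (ev t : borel (AC2 X) -> borel X).
Proof. apply: (@continuous_borel (AC2 X) X). exact: ev_continuous. Qed.

Lemma measurable_dist_curve (s t : R) :
  measurable_fun setT (fun c : borel (AC2 X) => mdist (ev s c) (ev t c)).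
Proof.
apply: continuous_borel_real => c.
by apply: (@mdist_continuous2 R X (AC2 X)); exact: ev_continuous.
Qed.

(** A cozero function composed with the evaluation is continuous in the curve
    and in the time separately, hence jointly measurable. *)
Lemma measurable_eval : measurable_fun setT
  (fun p : borel (AC2 X) * R => ev p.2 p.1 : borel X).
Proof.
apply: (@measurability _ _ _ (borel X) setT _ (@open X)) => // _ [U oU <-].
have [phi cphi ->] := open_cozero oU.
rewrite setTI.
have mphi : measurable_fun setT
    (fun p : borel (AC2 X) * R => phi (ev p.2 p.1)).
  apply: (@measurable_caratheodory R _ (borel (AC2 X)) (fun c s => phi (ev s c))).
    move=> s; apply: continuous_borel_real => c.
    by apply: continuous_comp; [exact: ev_continuous|exact: cphi].
  move=> c s; apply: (@continuous_comp _ _ _ (val c : R -> X) phi).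
    exact: curve_continuous.
  exact: cphi.
rewrite [X in measurable X](_ : _ =
    setT `&` (fun p : borel (AC2 X) * R => phi (ev p.2 p.1)) @^-1` `]0, +oo[%classic).
  by apply: mphi => //; exact: measurable_itv.
by rewrite setTI; apply/seteqP; split => p /=; rewrite in_itv/= andbT.
Qed.

Lemma measurable_curve (c : AC2 X) :
  measurable_fun setT (fun s : R => ev s c : borel X).
Proof.
have := measurable_eval.
exact: (@measurable_fun_pair2 _ _ _ (borel (AC2 X)) _ (borel X) (fun p => ev p.2 p.1) c).
Qed.

End evaluation.

(** * Joint measurability of the metric speed *)

Section dnbhs0.
Context {R : realType}.
Local Open Scope ring_scope.

(** Away from [0] the values of [phi] are limits of its values at rationals,
    so Cauchy's criterion for the limit at [0] consists of countably many
    conditions; this makes the existence of the metric speed a measurable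
    event. *)
Lemma cvg_dnbhs0_ratP (phi : R -> R) : (forall h, h != 0 -> {for h, continuous phi}) ->
  cvg (phi h @[h --> 0^']) <->
  forall k, exists n, forall q r : rat,
    0 < `|ratr q : R| < n.+1%:R^-1 -> 0 < `|ratr r : R| < n.+1%:R^-1 ->
    `|phi (ratr q) - phi (ratr r)| <= k.+1%:R^-1.
Proof.
move=> cphi; split.
- move=> /cvg_ex[l phil] k.
  have e0 : 0 < (k.+1%:R^-1 / 2 : R) by rewrite divr_gt0.
  move/cvgrPdist_lt : phil => /(_ _ e0).
  move=> /nbhs_ballP[e /= e1 he].
  near \oo => n.
  have ne : n.+1%:R^-1 < e by near: n; exact: near_infty_natSinv_lt (PosNum e1).
  have H (x : rat) : 0 < `|ratr x : R| < n.+1%:R^-1 ->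
      `|l - phi (ratr x)| < k.+1%:R^-1 / 2.
    move=> /andP[x0 xn]; apply: he; last by rewrite -normr_gt0.
    by rewrite /ball/= sub0r normrN; exact: lt_trans ne.
  exists n => q r /H + /H; move: (phi _) (phi _) => u v hq hr.
  apply: (le_trans (ler_distD l _ _)); rewrite [leRHS]splitr lerD//; last exact: ltW.
  by rewrite distrC ltW.
- move=> H; apply/cauchy_cvgP/cauchy_exP => e e0.
  near \oo => k.
  have ke : k.+1%:R^-1 < e by near: k; exact: near_infty_natSinv_lt (PosNum e0).
  have [n Hn] := H k.
  have n0 : 0 < n.+1%:R^-1 :> R by rewrite invr_gt0.
  have n1 : 0 < n.+2%:R^-1 :> R by rewrite invr_gt0.
  have rE : ratr (n.+2%:R^-1 : rat) = n.+2%:R^-1 :> R by rewrite rmorphV/= ?ratr_nat// unitfE.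
  exists (phi (ratr (n.+2%:R^-1))).

  apply/nbhs_ballP; exists n.+1%:R^-1 => //= h.
  rewrite /ball/= sub0r normrN => hn h0.
  have d0 : 0 < e - k.+1%:R^-1 by rewrite subr_gt0.
  have /cvgrPdist_lt/(_ _ d0) h1 := cphi h h0.
  have h2 : \forall x \near h, 0 < `|x| < n.+1%:R^-1.
    have nn : continuous (fun x : R => `|x|) by exact: norm_continuous.
    near=> x; apply/andP; split.
      by near: x; apply: (cvgr_gt `|h|) => //; [exact: nn|rewrite normr_gt0].
    by near: x; apply: (cvgr_lt `|h|) => //; exact: nn.
  have [q [/= q1 q2]] := rat_dense_nbhs (filterI h1 h2).
  have /Hn/(_ q2) : 0 < `|ratr (n.+2%:R^-1 : rat) : R| < n.+1%:R^-1.
    by rewrite rE gtr0_norm// n1/= ltf_pV2 ?posrE// ltr_nat.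
  move=> h3; apply: (le_lt_trans (ler_distD (phi (ratr q)) _ _)).
  by rewrite -[ltRHS](subrKC (k.+1%:R^-1)) ler_ltD// distrC.
Unshelve. all: by end_near. Qed.

End dnbhs0.

Section speed.
Context {R : realType} {X : completeMetricType R}.
Local Open Scope ring_scope.

Definition speed_quotient (u : R -> X) (t h : R) : R :=
  mdist (u (t + h)) (u t) / `|h|.

Lemma metric_speedE (u : R -> X) t :
  metric_speed u t = lim (speed_quotient u t h @[h --> 0^']).
Proof. by []. Qed.

Lemma speed_quotient_continuous (c : AC2 X) (t h : R) : h != 0 ->
  {for h, continuous (speed_quotient (val c) t)}.
Proof.
move=> h0; apply: (@cvgM R R^o); last first.
  apply: cvgV; first by rewrite normr_eq0.
  exact: norm_continuous.
apply: (@mdist_continuous2 R X R (fun h => val c (t + h)) (cst (val c t))); last exact: cvg_cst.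
apply: (@continuous_comp _ _ _ (fun h : R => t + h) (val c : R -> X)).
  by apply: continuousD => //; exact: cvg_cst.
exact: curve_continuous.
Qed.

Lemma metric_speed_ge0 (u : R -> X) t : 0 <= metric_speed u t.
Proof.
rewrite metric_speedE; have [cu|/dvgP ->] := pselect (cvg (speed_quotient u t h @[h --> 0^'])).
  apply: limr_ge => //; apply: nearW => h; rewrite /speed_quotient.
  by rewrite divr_ge0// mdist_ge0.
by rewrite /point.
Qed.

Lemma measurable_bigcap_rat d (T : measurableType d) (F : rat -> set T) :
  (forall q, measurable (F q)) -> measurable (\bigcap_q F q).
Proof.
move=> mF; rewrite -[X in measurable X]setCK setC_bigcap.
by apply/measurableC/bigcupT_measurable_rat => q; exact: measurableC.
Qed.

Lemma measurable_speed_quotient (h : R) : measurable_fun setT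
  (fun p : borel (AC2 X) * R => speed_quotient (val p.1) p.2 h).
Proof.
apply: (@measurable_caratheodory R _ (borel (AC2 X)) (fun c s => speed_quotient (val c) s h)).
  move=> s; apply: measurable_funM => //.
  exact: (@measurable_dist_curve R X (s + h) s).
move=> c s; apply: (@cvgM R R^o); last exact: cvg_cst.
apply: (@mdist_continuous2 R X R (fun s => val c (s + h)) (val c : R -> X)).
  apply: (@continuous_comp _ _ _ (fun s : R => s + h) (val c : R -> X)).
    by apply: continuousD => //; exact: cvg_cst.
  exact: curve_continuous.
exact: curve_continuous.
Qed.

(** On the measurable set where the difference quotients converge, the speed
    is their limit along [1/n]; elsewhere it has the default value [0]. *)
Lemma measurable_speed : measurable_fun setT
  (fun p : borel (AC2 X) * R => metric_speed (val p.1) p.2).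
Proof.
pose Q (p : borel (AC2 X) * R) h := speed_quotient (val p.1) p.2 h.
pose D n (q : rat) := (0 < `|ratr q : R| < n.+1%:R^-1).
pose E := \bigcap_k \bigcup_n \bigcap_q \bigcap_r
  [set p | D n q -> D n r -> `|Q p (ratr q) - Q p (ratr r)| <= k.+1%:R^-1].
have EP p : E p <-> cvg (Q p h @[h --> 0^']).
  rewrite cvg_dnbhs0_ratP; last by move=> h h0; exact: speed_quotient_continuous.
  split=> [pE k|H k _].
    by have [n _ H] := pE k I; exists n => q r; exact: H.
  by have [n Hn] := H k; exists n => // q _ r _; exact: Hn.
have mE : measurable E.
  apply: bigcapT_measurable => k; apply: bigcupT_measurable => n.
  apply: measurable_bigcap_rat => q; apply: measurable_bigcap_rat => r.
  have [Dq|Dq] := boolP (D n q); last first.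
    by rewrite [X in measurable X](_ : _ = setT)//; apply/seteqP; split.
  have [Dr|Dr] := boolP (D n r); last first.
    by rewrite [X in measurable X](_ : _ = setT)//; apply/seteqP; split.
  have mQ : measurable_fun setT (fun p => `|Q p (ratr q) - Q p (ratr r)|).
    apply: measurableT_comp => //.
    by apply: measurable_funB; exact: measurable_speed_quotient.
  have := mQ measurableT `]-oo, k.+1%:R^-1]%classic (measurable_itv _).
  rewrite setTI; congr (measurable _); apply/seteqP; split => p /=; rewrite in_itv/=.
    by [].
  exact.
apply: (@measurable_fun_cvg _ _ _ _ (fun n p => \1_E p * Q p n.+1%:R^-1)).
  move=> n; apply: measurable_funM; first exact: measurable_indic.
  exact: measurable_speed_quotient.
move=> p _; rewrite metric_speedE indicE.
have [/[!inE] pE|/negP] := boolP (p \in E); last first.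
  rewrite inE EP => /dvgP ->; under eq_fun do rewrite mul0r.
  exact: cvg_cst.
under eq_fun do rewrite mul1r.
move/EP : pE => /cvg_ex[l pl].
rewrite (cvg_lim _ pl)//.
apply: (cvg_comp _ _ _ pl) => A.
rewrite /= => -[e /= e0 eA].
near=> n; apply: eA => /=.
  rewrite sub0r normrN gtr0_norm//.
  by near: n; exact: near_infty_natSinv_lt (PosNum e0).
by rewrite invr_neq0.
Unshelve. all: by end_near. Qed.

End speed.

(** * Scaling of the Lebesgue measure *)

Section scaling.
Context {R : realType}.
Local Notation leb := (@lebesgue_measure R).

Lemma measurable_mulrl (t : R) : measurable_fun setT ( *%R t : R -> R).
Proof. exact: mulrl_measurable. Qed.

(** Packs the image measure with its measurability proof, for use where a
    bundled measure is expected. *)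
Lemma pushforward_measure d1 d2 (T1 : measurableType d1) (T2 : measurableType d2)
    (mu : {measure set T1 -> \bar R}) (f : T1 -> T2) : measurable_fun setT f ->
  exists nu : {measure set T2 -> \bar R}, nu = pushforward mu f :> (_ -> _).
Proof. by move=> mf; unshelve eexists (pushforward mu f). Qed.

(** Both sides are measures in [A] that agree on half-open intervals. *)
Lemma lebesgue_measure_scale (t : R) (t0 : (0 < t)%R) (A : set R) : measurable A ->
  t%:E * pushforward leb ( *%R t : R -> measurableTypeR R) A = leb A.
Proof.
move=> mA; apply/esym.
have [nu nuE] := @pushforward_measure _ _ (measurableTypeR R) (measurableTypeR R) leb ( *%R t) (measurable_mulrl t).
rewrite -nuE.
pose mu := mscale (NngNum (ltW t0)) nu.
have H : forall X, ocitv X -> leb X = mu X; last exact: (lebesgue_measure_unique H mA).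
move=> _ [[a b] _ <-].
rewrite /mu [RHS]/= /mscale nuE /pushforward.
transitivity (t%:E * leb `](a / t)%R, (b / t)%R]%classic); last first.
  congr (_ * leb _); apply/esym.
  apply/seteqP; split => x/=; rewrite !in_itv/= ltr_pdivrMr// ler_pdivlMr//.
    by rewrite (mulrC t).
  by rewrite (mulrC t).
rewrite !lebesgue_measure_itv/= !lte_fin ltr_pM2r ?invr_gt0//.
case: ifPn => _; last by rewrite mule0.
by rewrite -!EFinB -EFinM -mulrBl mulrCA divff ?mulr1// gt_eqF.
Qed.

Lemma ge0_integral_scale (t : R) (t0 : (0 < t)%R) (F : R -> \bar R) :
  measurable_fun setT F -> (forall x, 0 <= F x) ->
  t%:E * \int[leb]_(s in `[0%R, 1%R]) F (t * s)%R = \int[leb]_(s in `[0%R, t]) F s.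
Proof.
move=> mF F0.
have [nu nuE] := @pushforward_measure _ _ (measurableTypeR R) (measurableTypeR R) leb ( *%R t) (measurable_mulrl t).
rewrite (_ : `[0%R, 1%R]%classic = ( *%R t : R -> measurableTypeR R) @^-1` `[0%R, t]); last first.
  apply/seteqP; split => x/=; rewrite !in_itv/= pmulr_rge0//.
    by rewrite -[X in _ -> _ && (_ <= X)%R]mulr1 ler_pM2l.
  by rewrite -[X in _ && (_ <= X)%R -> _]mulr1 ler_pM2l.
have mF' : measurable_fun `[0%R, t] F by exact: measurable_funTS.
have := @ge0_integral_pushforward _ _ (measurableTypeR R) (measurableTypeR R) R ( *%R t) (measurable_mulrl t) leb `[0%R, t]%classic F (measurable_itv _) mF' (fun y _ => F0 y).
move=> <-.
transitivity (t%:E * \int[nu]_(s in `[0%R, t]) F s).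
  congr (_ * _); apply: eq_measure_integral => A mA _.
  by rewrite nuE.
rewrite -(@ge0_integral_mscale _ _ R nu (`[0%R, t]%classic) (measurable_itv _) (NngNum (ltW t0)) F)//.
apply: eq_measure_integral => A mA _.
by have := lebesgue_measure_scale t0 mA; rewrite -nuE.
Qed.

End scaling.

(** * Reparametrised initial pieces of curves *)

Section restriction.
Context {R : realType} {X : completeMetricType R}.
Local Notation leb := (@lebesgue_measure R).
Local Open Scope ring_scope.

Definition restr_fun (t : R) (u : R -> X) (s : R) : X := u (clamp t * clamp s).

Lemma scale_dnbhs0 (t : R) : t != 0 -> ( *%R t) @ 0^' --> 0^'.
Proof.
move=> t0 A /nbhs_ballP[e /= e0 eA].
apply/nbhs_ballP; exists (e / `|t|) => /=; first by rewrite divr_gt0// normr_gt0.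
move=> h; rewrite /ball/= sub0r normrN ltr_pdivlMr ?normr_gt0// => ht h0.
apply: eA; last by rewrite mulf_neq0.
by rewrite /ball/= sub0r normrN normrM mulrC.
Qed.

(** The difference quotients of the two curves are proportional after a
    rescaling of the increment, so they converge or diverge together; when they
    diverge both sides are [0]. The end times are excluded because the
    reparametrised curve is constant beyond them. *)
Lemma metric_speed_restr (t s : R) (c : AC2 X) : 0 < t <= 1 -> 0 < s < 1 ->
  metric_speed (restr_fun t (val c)) s = t * metric_speed (val c) (t * s).
Proof.
move=> /andP[t0 t1] /andP[s0 s1].
have tE : clamp t = t by rewrite clamp_id// ltW//= t1.
have t0' : t != 0 by rewrite gt_eqF.
pose q := speed_quotient (val c) (t * s).
pose Q := speed_quotient (restr_fun t (val c)) s.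
have QE : \forall h \near 0^', Q h = t * q (t * h).
  have : \forall h \near (0 : R), `|h| < Num.min s (1 - s).
    have := @norm_continuous _ R 0 => /cvgr_lt; apply.
    by rewrite normr0 lt_min s0 subr_gt0.
  move=> /nbhs_dnbhs; apply: filterS => h; rewrite lt_min !ltr_norml => /andP[/andP[h1 h2] /andP[h3 h4]].
  rewrite /Q /q /speed_quotient /restr_fun tE !clamp_id; last 2 first.
  - by rewrite (ltW s0) (ltW s1).
  - by apply/andP; split; lra.
  rewrite mulrDr normrM (gtr0_norm t0) invfM.
  by rewrite mulrCA (mulrA t) divff// mul1r.
have cvgQ l : q h @[h --> 0^'] --> l -> Q h @[h --> 0^'] --> t * l.
  move=> ql; have : t * q (t * h) @[h --> 0^'] --> t * l.
    apply: (@cvgM R R^o); first exact: cvg_cst.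
    by apply: (cvg_comp _ _ (scale_dnbhs0 t0') ql).
  move=> H; apply: cvg_trans H; apply: near_eq_cvg; move: QE; apply: filterS => h.
  by move=> ->.
have cvgq l : Q h @[h --> 0^'] --> l -> q h @[h --> 0^'] --> t^-1 * l.
  move=> Ql; have : t^-1 * Q (t^-1 * h) @[h --> 0^'] --> t^-1 * l.
    apply: (@cvgM R R^o); first exact: cvg_cst.
    by apply: (cvg_comp _ _ _ Ql); apply: scale_dnbhs0; rewrite invr_neq0.
  move=> H; apply: cvg_trans H; apply: near_eq_cvg.
  have := @scale_dnbhs0 t^-1; rewrite invr_neq0// => /(_ isT _ QE) QE'.
  apply: (@filterS _ 0^' _ (fun h => Q (t^-1 * h) = t * q (t * (t^-1 * h))) _ _ QE').
  move=> h /= ->.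
  by rewrite mulKf// mulVKf.
rewrite !metric_speedE -/q -/Q.
have [/cvg_ex[l ql]|nq] := pselect (cvg (q h @[h --> 0^'])).
  by rewrite (cvg_lim _ ql)// (cvg_lim _ (cvgQ _ ql)).
rewrite (dvgP nq) (@dvgP _ (Q h @[h --> 0^'])) ?mulr0//.
by move=> /cvg_ex[l Ql]; apply: nq; apply/cvg_ex; eexists; exact: cvgq Ql.
Qed.

Lemma measurable_metric_speed (c : AC2 X) :
  measurable_fun setT (metric_speed (val c)).
Proof.
exact: (@measurable_fun_pair2 _ _ _ (borel (AC2 X)) R R (fun p => metric_speed (val p.1) p.2) c measurable_speed).
Qed.

Lemma metric_speed_cst (x : X) s : metric_speed (fun=> x) s = 0.
Proof.
rewrite metric_speedE; apply/cvg_lim => //; rewrite /speed_quotient.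
under eq_fun do rewrite mdistxx mul0r; exact: cvg_cst.
Qed.

Local Open Scope ereal_scope.

Lemma energy_restr (t : R) (c : AC2 X) : (0 <= t <= 1)%R ->
  \int[leb]_(s in `[0%R, 1%R]) (metric_speed (restr_fun t (val c)) s ^+ 2)%:E =
  t%:E * \int[leb]_(s in `[0%R, t]) (metric_speed (val c) s ^+ 2)%:E.
Proof.
move=> /andP[t0 t1]; move: (t0); rewrite le_eqVlt => /predU1P[<-|{}t0].
  rewrite mul0e (_ : restr_fun 0 (val c) = fun=> val c 0%R).
    under eq_integral do rewrite metric_speed_cst expr0n/=.
    exact: integral0.
  apply/funext => s; rewrite /restr_fun (_ : clamp 0 = 0)%R ?mul0r//.
  by rewrite clamp_id// lexx ler01.
have mF : measurable_fun setT (fun s => metric_speed (val c) s ^+ 2)%R.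
  by apply: measurable_funX; exact: measurable_metric_speed.
have mts : measurable_fun setT (fun s => (t * metric_speed (val c) (t * s)) ^+ 2)%R.
  apply: measurable_funX; apply: measurable_funM => //.
  apply: measurableT_comp; first exact: measurable_metric_speed.
  exact: measurable_mulrl.
have E : {in `]0%R, 1%R[, (fun s => (t * metric_speed (val c) (t * s)) ^+ 2)%R
    =1 (fun s => (metric_speed (restr_fun t (val c)) s) ^+ 2)%R}.
  by move=> s; rewrite in_itv/= => s01; rewrite metric_speed_restr// t0.
rewrite -(@eq_integral_itv_bounded _ _ _ _ _ true false _ _ E)//; last 2 first.
- exact: measurable_funTS.
- apply: eq_measurable_fun (measurable_funTS mts) => s; rewrite inE => /E ->.
  by [].
rewrite -(ge0_integral_scale t0 (F := fun s => (metric_speed (val c) s ^+ 2)%:E)); last 2 first.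
- exact/measurable_EFinP.
- by move=> s; rewrite lee_fin sqr_ge0.
rewrite muleA -EFinM -expr2.
rewrite -ge0_integralZl//.
- by apply: eq_integral => s _; rewrite exprMn EFinM.
- apply/measurable_EFinP/measurable_funTS.
  apply: (measurableT_comp mF); exact: measurable_mulrl.
- by move=> s _; rewrite lee_fin sqr_ge0.
- by rewrite lee_fin sqr_ge0.
Qed.

Lemma ac2_curves_restr (t : R) (c : AC2 X) : ac2_curves (restr_fun t (val c)).
Proof.
have /andP[t0 t1] := clamp_itv t.
have [_ cac cen] := curveP c.
split.
- by move=> s; rewrite /restr_fun -!/(clamp _) (clamp_id (clamp_itv s)).
- move=> e e0; have [d d0 h] := cac e e0; exists d => // n a b ab ab_disj abd.
  have {}ab i : (0 <= a i <= 1 /\ 0 <= b i <= 1 /\ a i <= b i)%R.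
    have [a0 [aib b1]] := ab i.
    by rewrite a0 b1 (le_trans a0 aib) (le_trans aib b1).
  have := h n (fun i => clamp t * a i)%R (fun i => clamp t * b i)%R.
  have -> : (\sum_(i < n) mdist (val c (clamp t * a i)) (val c (clamp t * b i)) =
    \sum_(i < n) mdist (restr_fun t (val c) (a i)) (restr_fun t (val c) (b i)))%R.
    apply: eq_bigr => i _; have [ai [bi _]] := ab i.
    by rewrite /restr_fun (clamp_id ai) (clamp_id bi).
  apply.
  + move=> i; have [/andP[a0 a1] [/andP[b0 b1] aibi]] := ab i; split.
      by rewrite mulr_ge0.
    by rewrite ler_wpM2l// mulr_ile1.
  + apply/trivIsetP => i j _ _ ij; apply/seteqP; split => // y [] /=.
    rewrite !in_itv/= => /andP[y1 y2] /andP[y3 y4].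
    have ct : (0 < clamp t)%R.
      rewrite lt_neqAle t0 andbT; apply/eqP => t0'.
      by move: y1 y2; rewrite -t0' !mul0r => y1 /(lt_trans y1); rewrite ltxx.
    have /trivIsetP/(_ i j Logic.I Logic.I ij)/seteqP[/(_ (y / clamp t)%R) + _] := ab_disj.
    apply; split; rewrite /= in_itv/= ltr_pdivrMr// ltr_pdivlMr//.
      by rewrite mulrC y1 mulrC y2.
    by rewrite mulrC y3 mulrC y4.
  + apply: le_lt_trans abd; apply: ler_sum => i _; rewrite -mulrBr.
    have [_ [_ aibi]] := ab i.
    by rewrite ler_piMl// subr_ge0.
- rewrite (_ : restr_fun t = restr_fun (clamp t)); last first.
    by apply/funext => u; apply/funext => s; rewrite /restr_fun (clamp_id (clamp_itv t)).
  rewrite energy_restr ?clamp_itv//.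
  apply: (@le_lt_trans _ _ (\int[leb]_(s in `[0%R, 1%R]) (metric_speed (val c) s ^+ 2)%:E)); last exact: cen.
  have i0 (A : set R) : 0 <= \int[leb]_(s in A) (metric_speed (val c) s ^+ 2)%:E.
    by apply: integral_ge0 => s _; rewrite lee_fin sqr_ge0.
  rewrite -[leRHS]mul1e lee_pmul//.
  apply: ge0_subset_integral => //.
  + apply/measurable_EFinP/measurable_funTS.
    by apply: measurable_funX; exact: measurable_metric_speed.
  + by move=> s _; rewrite lee_fin sqr_ge0.
  + by apply: subset_itvl; rewrite bnd_simp.
Qed.

Definition restr (t : R) (c : AC2 X) : AC2 X :=
  SigSub (mem_set (ac2_curves_restr t c)).

Lemma ev_restr (t s : R) (c : AC2 X) : (0 <= t <= 1)%R -> (0 <= s <= 1)%R ->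
  ev s (restr t c) = ev (t * s) c.
Proof. by move=> t01 s01; rewrite /ev/= /restr_fun !clamp_id. Qed.

Lemma restr_continuous (t : R) : continuous (restr t : AC2 X -> AC2 X).
Proof.
move=> c P /nbhs_AC2P[e e0 eP]; apply/nbhs_AC2P; exists e => // c' cc'.
apply: eP => s _; apply: cc'.
have /andP[t0 t1] := clamp_itv t; have /andP[s0 s1] := clamp_itv s.
by rewrite mulr_ge0// mulr_ile1.
Qed.

Lemma measurable_restr (t : R) :
  measurable_fun setT (restr t : borel (AC2 X) -> borel (AC2 X)).
Proof. apply: (@continuous_borel (AC2 X) (AC2 X)); exact: restr_continuous. Qed.

Lemma energy_fin (t : R) (c : AC2 X) : (0 <= t <= 1)%R ->
  \int[leb]_(s in `[0%R, t]) (metric_speed (val c) s ^+ 2)%:E \is a fin_num.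
Proof.
move=> /andP[t0 t1]; have [_ _ cen] := curveP c.
rewrite ge0_fin_numE; last by apply: integral_ge0 => s _; rewrite lee_fin sqr_ge0.
apply: le_lt_trans cen; apply: ge0_subset_integral => //.
+ apply/measurable_EFinP/measurable_funTS.
  by apply: measurable_funX; exact: measurable_metric_speed.
+ by move=> s _; rewrite lee_fin sqr_ge0.
+ by apply: subset_itvl; rewrite bnd_simp.
Qed.

Lemma Et_sqr (t : R) (c : AC2 X) : (0 <= t <= 1)%R ->
  (Et t c ^+ 2)%:E = t%:E * \int[leb]_(s in `[0%R, t]) (metric_speed (val c) s ^+ 2)%:E.
Proof.
move=> t01; have /andP[t0 t1] := t01.
rewrite /Et sqr_sqrtr ?EFinM ?fineK//; first exact: energy_fin.
rewrite mulr_ge0// fine_ge0// integral_ge0// => s _.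
by rewrite lee_fin sqr_ge0.
Qed.

Lemma Et_ge0 (t : R) (c : AC2 X) : (0 <= Et t c)%R.
Proof. exact: sqrtr_ge0. Qed.

(** What makes the restriction useful: an estimate in terms of [Et 1] that
    holds for all test plans becomes one in terms of [Et t]. *)
Lemma Et_restr (t : R) (c : AC2 X) : (0 <= t <= 1)%R ->
  Et 1 (restr t c) = Et t c.
Proof.
move=> t01; have i11 : (0 <= (1 : R) <= 1)%R by rewrite ler01 lexx.
have sqr_inj (a b : R) : (0 <= a -> 0 <= b -> a ^+ 2 = b ^+ 2 -> a = b)%R.
  by move=> a0 b0 E; rewrite -(ger0_norm a0) -(ger0_norm b0) -!sqrtr_sqr E.
apply: sqr_inj; [exact: Et_ge0|exact: Et_ge0|apply: EFin_inj].
apply: (etrans (Et_sqr (restr t c) i11)); rewrite mul1e.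
by apply: (etrans (energy_restr c t01)); exact/esym/Et_sqr.
Qed.

End restriction.

(** * Functions that are measurable up to null sets *)

Section lower_integral.
Context d (T : measurableType d) (R : realType) (mu : {measure set T -> \bar R}).
Implicit Types F H : T -> \bar R.
Import HBNNSimple.

(** The integral of a nonnegative function is a supremum over the simple
    functions below it, whence its monotonicity for arbitrary functions. *)
Lemma ge0_integral_homo F H : (forall x, 0 <= F x) -> (forall x, F x <= H x) ->
  \int[mu]_x F x <= \int[mu]_x H x.
Proof.
move=> F0 FH; have H0 x : 0 <= H x by exact: le_trans (F0 x) (FH x).
rewrite !ge0_integralTE//; apply: ge_ereal_sup => _ [h hF <-].
by apply: ereal_sup_ubound; exists h => // x; exact: le_trans (hF x) (FH x).
Qed.

Lemma ge0_le_integral_off_null F H N : measurable N -> mu N = 0 ->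
  measurable_fun setT H -> (forall x, 0 <= F x) -> (forall x, 0 <= H x) ->
  (forall x, ~ N x -> F x <= H x) -> \int[mu]_x F x <= \int[mu]_x H x.
Proof.
move=> mN N0 mH F0 H0 FH.
rewrite (ge0_integralTE mu F0); apply: ge_ereal_sup => _ [h hF <-].
rewrite -integralT_nnsfun; apply: ae_ge0_le_integral => //.
- by move=> x _; rewrite lee_fin.
- exact/measurable_EFinP.
- exists N; split => // x; apply: contra_notP => /FH Nx _.
  by apply: le_trans Nx; exact: hF.
Qed.

Lemma ge0_integral_off_null F H N : measurable N -> mu N = 0 ->
  measurable_fun setT H -> (forall x, 0 <= F x) -> (forall x, 0 <= H x) ->
  (forall x, ~ N x -> F x = H x) -> \int[mu]_x F x = \int[mu]_x H x.
Proof.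
move=> mN N0 mH F0 H0 FH; apply/eqP; rewrite eq_le; apply/andP; split.
  by apply: (ge0_le_integral_off_null mN N0) => // x /FH ->.
rewrite (ge0_negligible_integral mN measurableT mH (fun x _ => H0 x) N0).
rewrite setTD integral_mkcond; apply: ge0_integral_homo => x.
  by rewrite patchE; case: ifPn.
by rewrite patchE; case: ifPn => // /[!inE] /FH ->.
Qed.

(** Integrals against a measure on the Borel sigma-algebra may be computed
    with a Borel version, even if [F] itself is not Borel. *)
Lemma integral_off_null F H N (D : set T) : measurable N -> mu N = 0 -> measurable D ->
  measurable_fun D H -> (forall x, D x -> ~ N x -> F x = H x) ->
  \int[mu]_(x in D) F x = \int[mu]_(x in D) H x.
Proof.
move=> mN N0 mD mH FH; rewrite integral_mkcond [RHS]integral_mkcond.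
have {}mH : measurable_fun setT (H \_ D) by exact/(measurable_restrictT _ _).1.
have {FH} : forall x, ~ N x -> (F \_ D) x = (H \_ D) x.
  by move=> x Nx; rewrite !patchE; case: ifPn => // /[!inE] Dx; exact: FH.
move: (F \_ D) (H \_ D) mH => {}F {}H mH FH.
rewrite integralE [RHS]integralE; congr (_ - _).
  apply: (ge0_integral_off_null mN N0) => //; first exact: measurable_funepos.
  by move=> x Nx; rewrite !funeposE FH.
apply: (ge0_integral_off_null mN N0) => //; first exact: measurable_funeneg.
by move=> x Nx; rewrite !funenegE FH.
Qed.

End lower_integral.

Section completion.
Context d (T : measurableType d) (R : realType) (m : {measure set T -> \bar R}).

(** The sets that agree with a measurable set off a null set form a
    sigma-algebra containing the generators of the completion. *)
Lemma completed_algebra_mod_null (A : set T) :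
  (completed_algebra_gen m).-sigma.-measurable A ->
  exists B N, [/\ measurable B, measurable N, m N = 0 & A `\` N = B `\` N].
Proof.
move: A; apply: smallest_sub => /=.
  split => /=.
  - by exists set0, set0; split.
  - move=> A [B [N [mB mN N0 AB]]]; exists (~` B), N; split => //.
      exact: measurableC.
    rewrite !setTD; apply/seteqP; split => x [Ax Nx]; split => // /[dup] Bx.
      by move=> _; apply: Ax; have [] : (A `\` N) x by rewrite AB.
    by move=> _; apply: Ax; have [] : (B `\` N) x by rewrite -AB.
  - move=> F /choice[B /choice[N BN]].
    exists (\bigcup_i B i), (\bigcup_i N i).
    have mN i : measurable (N i) by have [] := BN i.
    split.
    + by apply: bigcupT_measurable => i; have [] := BN i.
    + exact: bigcupT_measurable.
    + apply/negligibleP; first exact: bigcupT_measurable.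
      by apply: negligible_bigcup => i; apply/negligibleP => //; have [] := BN i.
    + apply/seteqP; split => x [[i _ Ax] Nx].
        have [_ _ _ ABi] := BN i.
        have [Bx _] : (B i `\` N i) x.
          by rewrite -ABi; split => //; apply: contra_not Nx => ?; exists i.
        by split => //; exists i.
      have [_ _ _ ABi] := BN i.
      have [Bx _] : (F i `\` N i) x.
        by rewrite ABi; split => //; apply: contra_not Nx => ?; exists i.
      by split => //; exists i.
move=> _ [A mA [N [M [mM M0 NM]]] <-]; exists A, M; split => //.
apply/seteqP; split => x [].
  by move=> [Ax Mx|/NM].
by move=> Ax Mx; split => //; left.
Qed.

Lemma measure_bigcup_countable0 (I : countType) (F : I -> set T) : (forall q, measurable (F q)) ->
  (forall q, m (F q) = 0) -> m (\bigcup_q F q) = 0.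
Proof.
move=> mF F0; pose E n := if unpickle n is Some q then F q else set0 : set T.
have -> : \bigcup_q F q = \bigcup_n E n.
  apply/seteqP; split => x [].
    by move=> q _ Fqx; exists (pickle q) => //; rewrite /E pickleK.
  by move=> n _; rewrite /E; case: unpickle => // q Fqx; exists q.
have mE n : measurable (E n) by rewrite /E; case: unpickle.
apply/negligibleP; first exact: bigcupT_measurable.
apply: negligible_bigcup => n; apply/negligibleP => //.
by rewrite /E; case: unpickle.
Qed.

(** The superlevel sets at rational levels determine [G], and each of them is
    measurable off a null set; [b] vanishes on the union of these null sets and
    equals [G] elsewhere. *)
Lemma completed_measurable_fun_mod_null (G : T -> \bar R) :
  measurable_fun setT (G : g_sigma_algebraType (completed_algebra_gen m) -> \bar R) ->
  (forall x, 0 <= G x) ->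
  exists b N, [/\ measurable_fun setT (b : T -> \bar R), forall x, 0 <= b x,
    measurable N, m N = 0 & forall x, ~ N x -> G x = b x].
Proof.
move=> mG G0.
have : forall q : rat, exists BN : set T * set T,
   [/\ measurable BN.1, measurable BN.2, m BN.2 = 0 &
    [set x | (ratr q : R)%:E < G x] `\` BN.2 = BN.1 `\` BN.2].
  move=> q.
  have := mG measurableT `](ratr q : R)%:E, +oo[%classic (emeasurable_itv _).
  rewrite setTI preimage_itvoy => /completed_algebra_mod_null[B [N BN]].
  by exists (B, N).
move=> /choice[BN BNP].
pose N := \bigcup_q (BN q).2.
have mN : measurable N by apply: bigcupT_measurable_rat => q; have [] := BNP q.
have N0 : m N = 0.
  by apply: measure_bigcup_countable0 => q; have [] := BNP q.
pose b x := if x \in N then 0 else G x.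
exists b, N; split => //.
- move=> _; apply: (measurability _ (ErealGenOInfty.measurableE R)) => //.
  move=> _ [_ [r ->] <-]; rewrite setTI preimage_itvoy.
  rewrite [X in measurable X](_ : _ = (if (r < 0)%R then N else set0) `|`
     ((\bigcup_q (if (r <= ratr q)%R then (BN q).1 else set0)) `\` N)).
    apply: measurableU; first by case: ifPn.
    apply: measurableD => //; apply: bigcupT_measurable_rat => q.
    by case: ifPn => // _; have [] := BNP q.
  apply/seteqP; split => x /=; rewrite /b.
  + case: ifPn => [/[!inE] Nx|/negP Nx] rx.
      by left; rewrite -lte_fin rx.
    rewrite inE in Nx; right; split => //.
    have [q rq qx] : exists2 q : rat, (r <= ratr q)%R & (ratr q)%:E < G x.
      move: rx; case: (G x) (G0 x) => [y||]// _; last first.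
        move=> _; have [q] := @rat_dense_nbhs R (r + 1)%R (ball (r + 1)%R 1%R) (nbhsx_ballx _ _ ltr01).
        rewrite /ball/= ltr_norml => /andP[_ h]; exists q; last exact: ltry.
        by rewrite ltW//; move: h; lra.
      rewrite lte_fin => ry.
      have mid : ((r + y) / 2)%R \in `]r, y[ by rewrite in_itv/=; apply/andP; split; lra.
      have [q] := @rat_dense_nbhs R ((r + y) / 2)%R `]r, y[%classic (near_in_itvoo mid).
      by rewrite /= in_itv/= => /andP[rq qy]; exists q; rewrite ?lte_fin// ltW.
    exists q => //; rewrite rq; have [_ _ _ BNE] := BNP q.
    have [//] : ((BN q).1 `\` (BN q).2) x.
    by rewrite -BNE; split => //; apply: contra_not Nx => ?; exists q.
  + case=> [|[[q _]]].
      by case: ifPn => // r0 Nx; rewrite mem_set.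
    case: ifPn => // rq BNx Nx; rewrite memNset//.
    have [_ _ _ BNE] := BNP q.
    have [+ _] : ([set x | (ratr q : R)%:E < G x] `\` (BN q).2) x.
      by rewrite BNE; split => //; apply: contra_not Nx => ?; exists q.
    by apply: le_lt_trans; rewrite lee_fin.
- by move=> x; rewrite /b; case: ifPn.
- by move=> x Nx; rewrite /b memNset.
Qed.

End completion.

(** * Test plans and almost every curve *)

Section ae_curve.
Context {R : realType} {X : completeMetricType R}.
Variable m : probability (borel X) R.
Local Notation leb := (@lebesgue_measure R).

Lemma ae_curveS (P Q : AC2 X -> Prop) : (forall c, P c -> Q c) ->
  ae_curve m P -> ae_curve m Q.
Proof.
move=> PQ [N [mN N0 PN]]; exists N; split => // c Qc; apply: PN.
by apply: contra_not Qc; exact: PQ.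
Qed.

Lemma ae_curveI (P Q : AC2 X -> Prop) :
  ae_curve m P -> ae_curve m Q -> ae_curve m (fun c => P c /\ Q c).
Proof.
move=> [N [mN N0 PN]] [M [mM M0 QM]]; exists (N `|` M); split.
- exact: measurableU.
- by move=> pi tpi; apply: null_set_setU => //; [exact: N0|exact: M0].
- by move=> c /not_andP[/PN|/QM]; [left|right].
Qed.

Lemma measurable_time_integral (F : borel (AC2 X) * R -> \bar R) (D : set R) :
  measurable D -> measurable_fun setT F -> (forall p, 0 <= F p) ->
  measurable_fun setT (fun c : borel (AC2 X) => \int[leb]_(s in D) F (c, s)).
Proof.
move=> mD mF F0.
have mFD : measurable_fun setT (F \_ (setT `*` D)).
  apply/(measurable_restrictT _ _).1; first exact: measurableX.
  exact: measurable_funTS.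
have := @measurable_fun_fubini_tonelli_F _ _ (borel (AC2 X)) (measurableTypeR R) R leb _ mFD.
move=> /(_ _) H; apply: eq_measurable_fun (H _).
  move=> c _; rewrite [RHS]integral_mkcond; apply: eq_integral => s _.
  by rewrite !patchE in_setX in_setT.
by move=> p; rewrite patchE; case: ifPn.
Qed.

Lemma fubini_time (pi : probability (borel (AC2 X)) R)
    (F : borel (AC2 X) * R -> \bar R) (D : set R) :
  measurable D -> measurable_fun setT F -> (forall p, 0 <= F p) ->
  \int[pi]_c \int[leb]_(s in D) F (c, s) = \int[leb]_(s in D) \int[pi]_c F (c, s).
Proof.
move=> mD mF F0.
have mFD : measurable_fun setT (F \_ (setT `*` D)).
  apply/(measurable_restrictT _ _).1; first exact: measurableX.
  exact: measurable_funTS.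
have FD0 p : 0 <= (F \_ (setT `*` D)) p by rewrite patchE; case: ifPn.
have := @fubini_tonelli _ _ (borel (AC2 X)) (measurableTypeR R) R pi leb _ mFD FD0.
move=> H; transitivity (\int[pi]_x \int[leb]_y (F \_ ([set: borel (AC2 X)] `*` D)) (x, y)).
  apply: eq_integral => c _; rewrite integral_mkcond; apply: eq_integral => s _.
  by rewrite !patchE in_setX in_setT.
rewrite H [RHS]integral_mkcond; apply: eq_integral => s _.
rewrite patchE; case: ifPn => sD.
  by apply: eq_integral => c _; rewrite patchE in_setX in_setT/= sD.
rewrite -[RHS](@integral0 _ _ _ pi setT); apply: eq_integral => c _.
by rewrite patchE in_setX in_setT/= (negbTE sD).
Qed.

Lemma test_plan_integral (pi : probability (borel (AC2 X)) R) : test_plan m pi ->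
  exists2 C : R, (0 < C)%R & forall (phi : borel X -> \bar R) (t : R),
    measurable_fun setT phi -> (forall x, 0 <= phi x) -> (0 <= t <= 1)%R ->
    \int[pi]_c phi (ev t c) <= C%:E * \int[m]_x phi x.
Proof.
move=> [C C0 hC]; exists C => // phi t mphi phi0 t01.
have := @ge0_integral_pushforward _ _ (borel (AC2 X)) (borel X) R _ (measurable_ev t) pi setT phi measurableT mphi (fun y _ => phi0 y).
rewrite preimage_setT => <-.
have := @ge0_integral_mscale _ _ R m setT measurableT (NngNum (ltW C0)) phi mphi (fun x _ => phi0 x).
move=> <-.
have [nu nuE] := @pushforward_measure R _ _ (borel (AC2 X)) (borel X) pi _ (measurable_ev t).
apply: (@le_trans _ _ (\int[nu]_y phi y)).
  rewrite le_eqVlt; apply/orP; left; apply/eqP.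
  apply: eq_measure_integral => [|A mA _]; [exact: measurable_ev|by rewrite nuE].
apply: ge0_le_measure_integral => // A mA; rewrite nuE; exact: hC.
Qed.

(** By Tonelli's theorem, the average under a test plan of the time spent in
    [N] is at most [C * m N = 0]. The exceptional set is the Borel set of curves
    spending a positive time in [N], the same for all plans. *)
Lemma ae_curve_null (N : set (borel X)) : measurable N -> m N = 0 ->
  ae_curve m (fun c => leb (`[0%R, 1%R] `&` [set s | N (ev s c)]) = 0).
Proof.
move=> mN N0.
pose F (p : borel (AC2 X) * R) : \bar R := (\1_N (ev p.2 p.1))%:E.
have mF : measurable_fun setT F.
  have mi : measurable_fun setT (\1_N : borel X -> R) by exact: measurable_indic.
  apply/measurable_EFinP; exact: (measurableT_comp mi measurable_eval).
have F0 p : 0 <= F p by rewrite lee_fin.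
have mI := @measurable_time_integral F `[0%R, 1%R]%classic (measurable_itv _) mF F0.
(* [Z]: the curves that spend a positive time in [N]. *)
pose Z := [set c : borel (AC2 X) | 0 < \int[leb]_(s in `[0%R, 1%R]) F (c, s)].
have mZ : measurable Z.
  have := mI measurableT `]0, +oo[%classic (emeasurable_itv _).
  by rewrite setTI preimage_itvoy.
exists Z; split => //.
- move=> pi tpi.
  have [C C0 hC] := test_plan_integral tpi.
  have I0 c : 0 <= \int[leb]_(s in `[0%R, 1%R]) F (c, s).
    by apply: integral_ge0 => s _; exact: F0.
  have : \int[pi]_c `| \int[leb]_(s in `[0%R, 1%R]) F (c, s) | = 0.
    transitivity (\int[pi]_c \int[leb]_(s in `[0%R, 1%R]) F (c, s)).
      by apply: eq_integral => c _; rewrite (gee0_abs (I0 c)).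
    rewrite fubini_time//.
    apply: integral0_eq => s; rewrite /= in_itv/= => s01.
    apply/eqP; rewrite eq_le integral_ge0 ?andbT; last by move=> c _; exact: F0.
    apply: le_trans (hC (fun x => (\1_N x)%:E) s _ _ s01) _.
    + by apply/measurable_EFinP; exact: measurable_indic.
    + by move=> x; rewrite lee_fin.
    + have -> : \int[m]_x (\1_N x)%:E = 0; last by rewrite mule0.
      by rewrite (@integral_indic _ (borel X) R m setT measurableT N mN) setIT; exact: N0.
  move=> /(ae_eq_integral_abs pi measurableT mI)[M [mM M0 ZM]].
  apply: (@subset_measure0 _ _ _ pi Z M) => // c Zc; apply: ZM => /= h.
  by move: Zc; rewrite /Z/= h// ltxx.
- move=> c h; suff : 0 < \int[leb]_(s in `[0%R, 1%R]) F (c, s) by [].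
  rewrite lt_neqAle integral_ge0 ?andbT; last by move=> s _; exact: F0.
  have mNc : measurable ([set s | N (ev s c)] : set (measurableTypeR R)).
    by have := @measurable_curve R X c measurableT N mN; rewrite setTI.
  have E : \int[leb]_(s in `[0%R, 1%R]) F (c, s) = leb (`[0%R, 1%R] `&` [set s | N (ev s c)]).
    rewrite setIC -(@integral_indic _ (measurableTypeR R) R leb _ (measurable_itv _) _ mNc).
    by apply: eq_integral => s _; rewrite /F !indicE.
  by rewrite E eq_sym; apply/eqP.
Qed.

(** The marginal at time [s] of the image plan is the marginal of [pi] at time
    [t * s], so that the compression constant is unchanged. *)
Lemma test_plan_restr (pi : probability (borel (AC2 X)) R) (t : R) :
  test_plan m pi -> (0 <= t <= 1)%R ->
  exists2 pi' : probability (borel (AC2 X)) R, test_plan m pi' &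
    forall A, pi' A = pi (restr t @^-1` A).
Proof.
move=> [C C0 hC] /andP[t0 t1].
pose r : {mfun borel (AC2 X) >-> borel (AC2 X)} :=
  HB.pack (restr t : borel (AC2 X) -> borel (AC2 X)) (isMeasurableFun.Build _ _ _ _ _ (@measurable_restr R X t)).
exists (distribution pi r) => //; exists C => // s /andP[s0 s1] A mA.
apply: le_trans (hC (t * s)%R _ _ mA); last by rewrite mulr_ge0// mulr_ile1.
rewrite /pushforward/= /distribution/= /pushforward.
rewrite (_ : _ @^-1` _ = ev (t * s) @^-1` A)//.
by apply/seteqP; split => c /=; rewrite ev_restr// ?t0 ?s0.
Qed.

Lemma ae_curve_restr (pi : probability (borel (AC2 X)) R) (t : R) (P : AC2 X -> Prop) :
  test_plan m pi -> (0 <= t <= 1)%R -> ae_curve m P ->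
  exists N : set (borel (AC2 X)), [/\ measurable N, pi N = 0 &
    forall c, ~ N c -> P (restr t c)].
Proof.
move=> tpi t01 [N [mN N0 PN]].
have [pi' tpi' pi'E] := test_plan_restr tpi t01.
exists (restr t @^-1` N : set (borel (AC2 X))); split.
- by rewrite -[X in measurable X]setTI; exact: measurable_restr.
- by rewrite -pi'E N0.
- by move=> c Nc; apply: contrapT => /PN.
Qed.

End ae_curve.

(** * Square integrable functions *)

Section square_integrals.
Context d (T : measurableType d) (R : realType) (mu : {measure set T -> \bar R}).

Lemma poweR2 (x : \bar R) : 0 <= x -> x `^ 2 = x ^+ 2.
Proof.
case: x => [r||]//.
  by rewrite lee_fin => r0; rewrite poweR_EFin (powR_mulrn 2).
by move=> _; rewrite poweRyr.
Qed.

Lemma Lnorm2_sqr (F : T -> \bar R) :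
  'N[mu]_2%:E[F] ^+ 2 = \int[mu]_x (`|F x| ^+ 2).
Proof.
rewrite -poweR2 ?Lnorm_ge0// poweR_Lnorm//; apply: eq_integral => x _.
by rewrite poweR2.
Qed.

Lemma Lnorm2_EFin_sqr (u : T -> R) :
  'N[mu]_2%:E[EFin \o u] ^+ 2 = \int[mu]_x (u x ^+ 2)%:E.
Proof.
rewrite Lnorm2_sqr; apply: eq_integral => x _.
by rewrite -[`|_|]/((`|u x|%R)%:E) -EFin_expe real_normK// num_real.
Qed.

(** The squared form makes sense when integrals are infinite. *)
Lemma cauchy_schwarz (u v : T -> R) : measurable_fun setT u -> measurable_fun setT v ->
  (\int[mu]_x `|u x * v x|%:E) ^+ 2 <=
  \int[mu]_x (u x ^+ 2)%:E * \int[mu]_x (v x ^+ 2)%:E.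
Proof.
move=> mu_ mv; rewrite -!Lnorm2_EFin_sqr.
have := hoelder mu mu_ mv (p := 2) (q := 2).
rewrite Lnorm1 /= => /(_ _ _ _) H.
have {}H : \int[mu]_x `|u x * v x|%:E <= 'N[mu]_2%:E[EFin \o u] * 'N[mu]_2%:E[EFin \o v].
  apply: H => //; lra.
rewrite muleACA; apply: lee_pmul => //.
- by apply: integral_ge0 => x _; rewrite lee_fin.
- by apply: integral_ge0 => x _; rewrite lee_fin.
Qed.

End square_integrals.

Section square_integrable.
Context d (T : measurableType d) (R : realType) (P : {measure set T -> \bar R}).
Implicit Types u v w e : T -> R.

Definition sq_integrable u :=
  measurable_fun setT u /\ \int[P]_x (u x ^+ 2)%:E < +oo.

Lemma sq_integrable_sqr u : sq_integrable u -> P.-integrable setT (EFin \o (fun x => u x ^+ 2)%R).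
Proof.
move=> [mu uoo]; apply/integrableP; split.
  by apply/measurable_EFinP; exact: measurable_funX.
by under eq_integral do rewrite gee0_abs ?lee_fin ?sqr_ge0//.
Qed.

Lemma integrable_le u v : measurable_fun setT u ->
  P.-integrable setT (EFin \o v) -> (forall x, `|u x| <= v x)%R ->
  P.-integrable setT (EFin \o u).
Proof.
move=> mu iv uv; apply: le_integrable iv => //; first exact/measurable_EFinP.
by move=> x _ /=; rewrite lee_fin (le_trans (uv x))// ler_norm.
Qed.

Lemma integrable_EFinD u v : P.-integrable setT (EFin \o u) ->
  P.-integrable setT (EFin \o v) -> P.-integrable setT (EFin \o (fun x => u x + v x)%R).
Proof.
by move=> iu iv; rewrite /comp; under eq_fun do rewrite EFinD; exact: integrableD.
Qed.

Lemma integrable_EFinZ (k : R) u : P.-integrable setT (EFin \o u) ->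
  P.-integrable setT (EFin \o (fun x => k * u x)%R).
Proof.
by move=> iu; rewrite /comp; under eq_fun do rewrite EFinM; exact: integrableZl.
Qed.

Lemma sq_integrableM u v : sq_integrable u -> sq_integrable v ->
  P.-integrable setT (EFin \o (fun x => u x * v x)%R).
Proof.
move=> su sv.
have H := integrable_EFinD (sq_integrable_sqr su) (sq_integrable_sqr sv).
apply: (integrable_le _ H); first by apply: measurable_funM; [case: su|case: sv].
move=> x; have := sqr_ge0 (u x - v x)%R; have := sqr_ge0 (u x + v x)%R.
by rewrite ler_norml; move=> ? ?; apply/andP; split; nra.
Qed.

Lemma sq_integrableD u v (k : R) : sq_integrable u -> sq_integrable v ->
  sq_integrable (fun x => u x + k * v x)%R.
Proof.
move=> su sv; split.
  by apply: measurable_funD; [case: su|apply: measurable_funM => //; case: sv].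
have := integrable_EFinD (integrable_EFinZ 2 (sq_integrable_sqr su))
  (integrable_EFinZ (2 * k ^+ 2) (sq_integrable_sqr sv)).
move=> /integrableP[_]; apply: le_lt_trans.
apply: ge0_le_integral => //.
- by move=> x _; rewrite lee_fin sqr_ge0.
- apply/measurable_EFinP/measurable_funX.
  by apply: measurable_funD; [case: su|apply: measurable_funM => //; case: sv].
- apply: measurableT_comp => //; apply/measurable_EFinP.
  by apply: measurable_funD; apply: measurable_funM => //; apply: measurable_funX;
    [case: su|case: sv].
- move=> x _; rewrite /= lee_fin; apply: le_trans (ler_norm _).
  by have := sqr_ge0 (u x - k * v x)%R; nra.
Qed.

Lemma ler_Rintegral_sqr u (x : R) : sq_integrable u ->
  \int[P]_t (u t ^+ 2)%:E <= x%:E -> (\int[P]_t (u t ^+ 2) <= x)%R.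
Proof.
move=> su h; rewrite -lee_fin /Rintegral fineK//.
exact: (integrable_fin_num measurableT (sq_integrable_sqr su)).
Qed.

End square_integrable.

Lemma bounded_integrable d (T : measurableType d) (R : realType)
    (P : probability T R) (u : T -> R) (M : R) :
  measurable_fun setT u -> (forall x, `|u x| <= M)%R ->
  P.-integrable setT (EFin \o u).
Proof.
move=> mu uM; apply: (@integrable_le _ _ _ _ _ (fun=> M)) => //.
exact: finite_measure_integrable_cst.
Qed.


(** * Weak upper gradients in square integral form *)

Section representative.
Context {R : realType} {X : completeMetricType R}.
Variable m : probability (borel X) R.
Local Notation leb := (@lebesgue_measure R).

(** The data with which a square integrable weak gradient is handled: a real
    valued Borel version and an exceptional null set. *)
Definition sq_representative (G : X -> \bar R) (b : X -> R) (N : set (borel X)) :=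
  [/\ sq_integrable m (b : borel X -> R), forall x, (0 <= b x)%R,
      measurable N, m N = 0 & forall x, ~ N x -> G x = (b x)%:E].

(** Square integrability makes [G] finite almost everywhere, so that its
    infinite values can be moved to the exceptional set. *)
Lemma sq_representative_ex (G : X -> \bar R) :
  m_measurable m G -> (forall x, 0 <= G x) ->
  'N[m]_2%:E[(G : borel X -> \bar R)] < +oo ->
  exists b N, sq_representative G b N.
Proof.
move=> mG G0 Goo.
have [b [N [mb b0 mN N0 Gb]]] := completed_measurable_fun_mod_null mG G0.
have mb2 : measurable_fun setT (fun x : borel X => b x ^+ 2).
  by apply: emeasurable_funM.
have boo : \int[m]_x (b x ^+ 2) < +oo.
  rewrite -(@integral_off_null _ _ _ m (fun x => `|G x| ^+ 2) _ N)//; last first.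
    by move=> x _ /Gb ->; rewrite gee0_abs.
  rewrite -Lnorm2_sqr; apply: lte_mul_pinfty => //; first exact: Lnorm_ge0.
  by rewrite ge0_fin_numE// Lnorm_ge0.
have b20 x : 0 <= b x ^+ 2 by rewrite expe2 mule_ge0.
have ib : m.-integrable setT (fun x => b x ^+ 2).
  apply/integrableP; split => //.
  by under eq_integral do rewrite gee0_abs//.
have [M [mM M0 bM]] := integrable_ae measurableT ib.
exists (fun x => fine (b x)), (N `|` M); split.
- split.
  + exact: (measurableT_comp (fine_measurable measurableT)).
  + apply: le_lt_trans boo; apply: ge0_integral_homo => x.
      by rewrite lee_fin sqr_ge0.
    case: (b x) (b0 x) => [r _|_|//]; first by rewrite EFin_expe.
    by rewrite [fine _]/= expr0n; exact: mule_ge0.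
- by move=> x; rewrite fine_ge0.
- exact: measurableU.
- by apply: null_set_setU.
- move=> x /not_orP[Nx Mx]; rewrite Gb// fineK//.
  have : b x ^+ 2 \is a fin_num by apply: contrapT => h; apply: Mx; apply: bM => /= /(_ Logic.I).
  by case: (b x) (b0 x).
Qed.

(** Almost every curve meets the exceptional set at a null set of times only. *)
Lemma line_integral_representative (G : X -> \bar R) (b : X -> R) (N : set (borel X)) :
  sq_representative G b N ->
  ae_curve m (fun c =>
    \int[leb]_(t in `[0%R, 1%R]) (G (ev t c) * (metric_speed (val c) t)%:E) =
    \int[leb]_(t in `[0%R, 1%R]) (b (ev t c) * metric_speed (val c) t)%:E).
Proof.
move=> [[mb boo] b0 mN N0 Gb].
apply: ae_curveS (ae_curve_null mN N0) => c Nc.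
have mNc : measurable ([set s | N (ev s c)] : set (measurableTypeR R)).
  by have := @measurable_curve R X c measurableT N mN; rewrite setTI.
apply: (@integral_off_null _ (measurableTypeR R) R leb _ _ _ _ _ Nc) => //.
- by apply: measurableI => //; exact: measurable_itv.
- apply/measurable_EFinP/measurable_funTS/measurable_funM.
    exact: (measurableT_comp mb (measurable_curve c)).
  exact: measurable_metric_speed.
- by move=> s s01 Ns; rewrite Gb// => Nsc; apply: Ns.
Qed.

(** Cauchy-Schwarz in the line integral. The end values are finite because a
    difference of extended reals with an infinite term is infinite, while the
    line integral is finite. *)
Lemma weak_upper_gradient_sqr (f G : X -> \bar R) (b : X -> R) (N : set (borel X)) :
  weak_upper_gradient m f G -> sq_representative G b N ->
  ae_curve m (fun c => [/\ f (ev 0 c) \is a fin_num, f (ev 1 c) \is a fin_num &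
    `|f (ev 1 c) - f (ev 0 c)| ^+ 2 <=
     \int[leb]_(t in `[0%R, 1%R]) (b (ev t c) ^+ 2)%:E * (Et 1 c ^+ 2)%:E]).
Proof.
move=> [mG G0 Gf] bG; have [[mb boo] b0 mN N0 Gb] := bG.
apply: ae_curveS (ae_curveI Gf (line_integral_representative bG)) => c /= [[fI Ioo] IE].
have : f (ev 1 c) - f (ev 0 c) \is a fin_num.
  by rewrite -abse_fin_num ge0_fin_numE//; exact: le_lt_trans Ioo.
rewrite fin_numB => /andP[f1 f0]; split => //.
apply: (@le_trans _ _ ((\int[leb]_(t in `[0%R, 1%R]) (b (ev t c) * metric_speed (val c) t)%:E) ^+ 2)).
  by rewrite !expe2 -IE lee_pmul.
rewrite Et_sqr ?lexx ?ler01// mul1e.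
have mbc : measurable_fun setT (fun t => b (ev t c)).
  exact: (measurableT_comp mb (measurable_curve c)).
have mv := @measurable_metric_speed R X c.
pose u := (fun t => b (ev t c)) \_ (`[0%R, 1%R] : set R).
pose v := (metric_speed (val c)) \_ (`[0%R, 1%R] : set R).
have mU : measurable_fun setT u.
  by apply/(measurable_restrictT _ _).1; [exact: measurable_itv|exact: measurable_funTS].
have mV : measurable_fun setT v.
  by apply/(measurable_restrictT _ _).1; [exact: measurable_itv|exact: measurable_funTS].
rewrite integral_mkcond [X in _ <= X * _]integral_mkcond [X in _ <= _ * X]integral_mkcond.
have := @cauchy_schwarz _ (measurableTypeR R) R leb _ _ mU mV.
congr (_ <= _).
- congr (_ ^+ 2); apply: eq_integral => t _; rewrite /u /v !patchE.
  case: ifPn => _; last by rewrite mul0r normr0.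
  by rewrite ger0_norm// mulr_ge0// metric_speed_ge0.
- congr (_ * _); apply: eq_integral => t _; rewrite /u /v !patchE.
    by case: ifPn => _ //; rewrite expr0n.
  by case: ifPn => _ //; rewrite expr0n.
Qed.

Lemma sq_representativeD (G H : X -> \bar R) (a b : X -> R) (N M : set (borel X)) (e : R) :
  sq_representative G a N -> sq_representative H b M -> (0 <= e)%R ->
  sq_representative (fun x => H x + e%:E * G x) (fun x => b x + e * a x)%R (M `|` N).
Proof.
move=> [sa a0 mN N0 Ga] [sb b0 mM M0 Hb] e0; split.
- exact: sq_integrableD.
- by move=> x; rewrite addr_ge0// mulr_ge0.
- exact: measurableU.
- by apply: null_set_setU.
- by move=> x /not_orP[Mx Nx]; rewrite Hb// Ga.
Qed.

(** The line integrals add up because, on almost every curve, they are those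
    of the Borel representatives; lower integrals of non-measurable functions
    would only be superadditive. *)
Lemma weak_upper_gradientD (f g G H : X -> \bar R) (a b : X -> R) (N M : set (borel X)) (e : R) :
  weak_upper_gradient m f G -> sq_representative G a N ->
  weak_upper_gradient m g H -> sq_representative H b M -> (0 <= e)%R ->
  weak_upper_gradient m (fun x => g x + e%:E * f x) (fun x => H x + e%:E * G x).
Proof.
move=> [mG G0 Gf] aG [mH H0 Hg] bH e0.
have [[ma _] a0 _ _ _] := aG; have [[mb _] b0 _ _ _] := bH.
split.
- exact: (emeasurable_funD mH (emeasurable_funM (measurable_cst _) mG)).
- by move=> x; rewrite adde_ge0// mule_ge0.
have abGH := sq_representativeD aG bH e0.
have := ae_curveI (ae_curveI (ae_curveI Gf Hg) (line_integral_representative abGH))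
  (ae_curveI (line_integral_representative aG) (line_integral_representative bH)).
apply: ae_curveS => c /= [[[[Gc Goo] [Hc Hoo]] ->] [Ga' Hb']].
rewrite {}Ga' in Gc Goo; rewrite {}Hb' in Hc Hoo.
have fE : f (ev 1 c) - f (ev 0 c) \is a fin_num.
  by rewrite -abse_fin_num ge0_fin_numE//; exact: le_lt_trans Goo.
have gE : g (ev 1 c) - g (ev 0 c) \is a fin_num.
  by rewrite -abse_fin_num ge0_fin_numE//; exact: le_lt_trans Hoo.
have mv := @measurable_metric_speed R X c.
have mac : measurable_fun setT (fun t => a (ev t c)).
  exact: (measurableT_comp ma (measurable_curve c)).
have mbc : measurable_fun setT (fun t => b (ev t c)).
  exact: (measurableT_comp mb (measurable_curve c)).
have v0 := @metric_speed_ge0 R X (val c).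
have -> : \int[leb]_(t in `[0%R, 1%R]) ((b (ev t c) + e * a (ev t c)) * metric_speed (val c) t)%:E =
   \int[leb]_(t in `[0%R, 1%R]) (b (ev t c) * metric_speed (val c) t)%:E +
   e%:E * \int[leb]_(t in `[0%R, 1%R]) (a (ev t c) * metric_speed (val c) t)%:E.
  rewrite -ge0_integralZl_EFin//; last 2 first.
  - by move=> t _; rewrite lee_fin mulr_ge0.
  - exact/measurable_EFinP/measurable_funTS/measurable_funM.
  rewrite -ge0_integralD//.
  - by apply: eq_integral => t _; rewrite -EFinM -EFinD mulrDl mulrA.
  - by move=> t _; rewrite lee_fin mulr_ge0.
  - exact/measurable_EFinP/measurable_funTS/measurable_funM.
  - by move=> t _; rewrite mule_ge0// lee_fin mulr_ge0.
  - apply: emeasurable_funM => //.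
    exact/measurable_EFinP/measurable_funTS/measurable_funM.
split; last first.
  by rewrite lte_add_pinfty// lte_mul_pinfty.
apply: (@le_trans _ _ (`|g (ev 1 c) - g (ev 0 c)| + e%:E * `|f (ev 1 c) - f (ev 0 c)|)).
  move: fE gE; rewrite !fin_numB => /andP[] + + /andP[].
  move: (f (ev 1 c)) (f (ev 0 c)) (g (ev 1 c)) (g (ev 0 c)).
  move=> [x||]// [y||]// [z||]// [w||]// _ _ _ _.
  rewrite -!EFinM -!EFinD lee_fin.
  rewrite (_ : z + e * x - (w + e * y) = (z - w) + e * (x - y))%R; last by lra.
  by rewrite (le_trans (ler_normD _ _))// normrM (ger0_norm e0).
by apply: leeD => //; apply: lee_pmul.
Qed.

End representative.

(** * Continuity of the marginals of a test plan at time 0 *)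

Section initial_trace.
Context {R : realType} {X : completeMetricType R}.
Variables (m : probability (borel X) R) (pi : probability (borel (AC2 X)) R).
Hypothesis tpi : test_plan m pi.
Implicit Types phi psi : borel X -> R.

(** Weak continuity at time [0] of the marginals of [pi], tested on [phi]. *)
Definition trace_continuous phi :=
  (\int[pi]_c phi (ev r c))%R @[r --> (0%R : R)^'+] --> (\int[pi]_c phi (ev 0%R c))%R.

Lemma measurable_comp_ev phi (r : R) : measurable_fun setT phi ->
  measurable_fun setT (fun c : borel (AC2 X) => phi (ev r c)).
Proof. by move=> mphi; exact: (measurableT_comp mphi (measurable_ev r)). Qed.

Lemma integrable_comp_ev phi (r : R) : (0 <= r <= 1)%R ->
  m.-integrable setT (EFin \o phi) ->
  pi.-integrable setT (EFin \o (fun c : borel (AC2 X) => phi (ev r c))).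
Proof.
move=> r01 /integrableP[/measurable_EFinP mphi phioo]; apply/integrableP; split.
  by apply/measurable_EFinP; exact: measurable_comp_ev.
have [C C0 hC] := test_plan_integral tpi.
apply: le_lt_trans (hC (fun x => `|phi x|%:E) r _ _ r01) _ => //.
  by apply/measurable_EFinP; exact: measurableT_comp.
apply: lte_mul_pinfty => //; first by rewrite lee_fin ltW.
Qed.

Lemma near_right01 : \forall r \near (0%R : R)^'+, (0 <= r <= 1)%R.
Proof.
near=> r; apply/andP; split; first by near: r; exact: nbhs_right_ge.
by near: r; exact: nbhs_right_le.
Unshelve. all: by end_near. Qed.

Lemma trace_continuousD phi psi : m.-integrable setT (EFin \o phi) ->
  m.-integrable setT (EFin \o psi) -> trace_continuous phi -> trace_continuous psi ->
  trace_continuous (fun x => phi x + psi x)%R.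
Proof.
move=> iphi ipsi cphi cpsi; rewrite /trace_continuous.
rewrite RintegralD//; last 2 first.
- by apply: integrable_comp_ev => //; rewrite lexx ler01.
- by apply: integrable_comp_ev => //; rewrite lexx ler01.
have H : (\int[pi]_c phi (ev r c) + \int[pi]_c psi (ev r c))%R @[r --> (0%R : R)^'+] -->
  (\int[pi]_c phi (ev 0%R c) + \int[pi]_c psi (ev 0%R c))%R by exact: cvgD cphi cpsi.
 apply: cvg_trans H. apply: near_eq_cvg.
near=> r; have r01 : (0 <= r <= 1)%R by near: r; exact: near_right01.
by rewrite RintegralD//; exact: integrable_comp_ev.
Unshelve. all: by end_near. Qed.

Lemma trace_continuousZ (k : R) phi : m.-integrable setT (EFin \o phi) ->
  trace_continuous phi -> trace_continuous (fun x => k * phi x)%R.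
Proof.
move=> iphi cphi; rewrite /trace_continuous.
rewrite RintegralZl//; last by apply: integrable_comp_ev => //; rewrite lexx ler01.
have H : (k * \int[pi]_c phi (ev r c))%R @[r --> (0%R : R)^'+] -->
  (k * \int[pi]_c phi (ev 0%R c))%R by apply: cvgM cphi; exact: cvg_cst.
apply: cvg_trans H; apply: near_eq_cvg.
near=> r; have r01 : (0 <= r <= 1)%R by near: r; exact: near_right01.
by rewrite RintegralZl//; exact: integrable_comp_ev.
Unshelve. all: by end_near. Qed.

(** By bounded compression the error made in replacing [phi] by [psi] is at
    most [C] times their [L1(m)] distance, uniformly in time. *)
Lemma trace_continuous_approx phi : m.-integrable setT (EFin \o phi) ->
  (forall e : R, (0 < e)%R -> exists psi, [/\ m.-integrable setT (EFin \o psi),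
     trace_continuous psi & \int[m]_x `|phi x - psi x|%:E <= e%:E]) ->
  trace_continuous phi.
Proof.
move=> iphi H; have [C C0 hC] := test_plan_integral tpi.
apply/cvgrPdist_le => e e0.
have e3 : (0 < e / 3 / C)%R by rewrite !divr_gt0.
have [psi [ipsi cpsi psie]] := H _ e3.
have close (r : R) : (0 <= r <= 1)%R ->
    (`|\int[pi]_c phi (ev r c) - \int[pi]_c psi (ev r c)| <= e / 3)%R.
  move=> r01.
  rewrite -RintegralB//; [|exact: integrable_comp_ev|exact: integrable_comp_ev].
  have ippr : pi.-integrable setT (EFin \o (fun c : borel (AC2 X) => phi (ev r c) - psi (ev r c))%R).
    apply: (@integrable_comp_ev (fun x => phi x - psi x)%R) => //.
    rewrite /comp; under eq_fun do rewrite EFinB.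
    exact: integrableB.
  rewrite -lee_fin EFin_normr_Rintegral//.
  apply: (le_trans (le_abse_integral _ _ _)) => //; first by case/integrableP : ippr.
  have mB : measurable_fun setT (fun x => phi x - psi x)%R.
    by apply: measurable_funB; apply/measurable_EFinP;
      [exact: (measurable_int m iphi)|exact: (measurable_int m ipsi)].
  apply: le_trans (hC (fun x => `|phi x - psi x|%:E) r _ _ r01) _ => //.
    by apply/measurable_EFinP; exact: measurableT_comp.
  apply: (@le_trans _ _ (C%:E * (e / 3 / C)%:E)).
    by apply: lee_pmul => //; [rewrite lee_fin ltW|exact: integral_ge0].
  by rewrite -EFinM lee_fin mulrC divfK// gt_eqF.
have e30 : (0 < e / 3)%R by rewrite divr_gt0.
move/cvgrPdist_le : cpsi => /(_ _ e30) cpsi.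
near=> r.
have r01 : (0 <= r <= 1)%R by near: r; exact: near_right01.
have h1 := close _ r01.
have h0 : (`|\int[pi]_c phi (ev 0 c) - \int[pi]_c psi (ev 0 c)| <= e / 3)%R.
  by apply: close; rewrite lexx ler01.
have h2 : (`|\int[pi]_c psi (ev 0 c) - \int[pi]_c psi (ev r c)| <= e / 3)%R by near: r.
move: h0 h1 h2; rewrite !ler_norml => /andP[? ?] /andP[? ?] /andP[? ?].
by apply/andP; split; lra.
Unshelve. all: by end_near. Qed.

Lemma trace_continuous_L1 phi (psi_ : (borel X -> R)^nat) :
  m.-integrable setT (EFin \o phi) ->
  (forall n, m.-integrable setT (EFin \o psi_ n)) ->
  (forall n, trace_continuous (psi_ n)) ->
  (fun n => \int[m]_x `|phi x - psi_ n x|%:E) @ \oo --> 0 ->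
  trace_continuous phi.
Proof.
move=> iphi ipsi cpsi psi0; apply: trace_continuous_approx => // e e0.
have [n _ /(_ n (leqnn n)) /= h] : \forall n \near \oo, \int[m]_x `|phi x - psi_ n x|%:E < e%:E.
  apply: (psi0 [set y | y < e%:E]); apply: open_nbhs_nbhs; split; last by rewrite /= lte_fin.
  exact: open_ereal_lt_ereal.
by exists (psi_ n); split => //; exact: ltW.
Qed.

Lemma trace_continuous_dominated phi (psi_ : (borel X -> R)^nat) (M : R) :
  measurable_fun setT phi ->
  (forall n, measurable_fun setT (psi_ n)) ->
  (forall n x, `|psi_ n x| <= M)%R ->
  (forall n, trace_continuous (psi_ n)) ->
  (forall x, psi_ ^~ x @ \oo --> phi x) -> trace_continuous phi.
Proof.
move=> mphi mpsi psiM cpsi psiphi.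
have iM : m.-integrable setT (fun=> M%:E) by exact: finite_measure_integrable_cst.
have ipsi n : m.-integrable setT (EFin \o psi_ n).
  exact: (@bounded_integrable _ _ _ m _ M).
have [||||iphi D0 _] := @dominated_convergence _ (borel X) R m setT measurableT
  (fun n x => (psi_ n x)%:E) (EFin \o phi) (fun=> M%:E) _ _ _ iM _.
- by move=> n; exact/measurable_EFinP.
- exact/measurable_EFinP.
- apply: aeW => x _; apply/fine_cvgP; split; first exact: nearW.
  exact: psiphi.
- by apply: aeW => x n _; rewrite lee_fin.
apply: (@trace_continuous_L1 _ psi_) => //.
apply: cvg_trans D0; apply: near_eq_cvg; apply: nearW => n.
by apply: eq_integral => x _; rewrite -EFinB distrC.
Qed.

End initial_trace.

Section initial_trace_integrable.
Context {R : realType} {X : completeMetricType R}.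
Variables (m : probability (borel X) R) (pi : probability (borel (AC2 X)) R).
Hypothesis tpi : test_plan m pi.

(** Dominated convergence along the continuous curves. *)
Lemma trace_continuous_bounded (phi : X -> R) (M : R) : continuous phi ->
  (forall x, `|phi x| <= M)%R -> trace_continuous pi phi.
Proof.
move=> cphi phiM; apply/cvg_at_rightP => u [u0 ucvg].
have mphi : measurable_fun setT (phi : borel X -> R) by exact: continuous_borel_real.
have mphie r := @measurable_comp_ev R X phi r mphi.
have ib r : pi.-integrable setT (EFin \o (fun c => phi (ev r c))).
  by apply: (@bounded_integrable _ (borel (AC2 X)) R pi _ M).
have iM : pi.-integrable setT (fun=> M%:E) by exact: finite_measure_integrable_cst.
have [||||_ _ H] := @dominated_convergence _ (borel (AC2 X)) R pi setT measurableT
  (fun n c => (phi (ev (u n) c))%:E) (fun c => (phi (ev 0%R c))%:E) (fun=> M%:E) _ _ _ iM _.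
- by move=> n; exact/measurable_EFinP.
- exact/measurable_EFinP.
- apply: aeW => c _; apply/fine_cvgP; split; first exact: nearW.
  apply: (cvg_comp u (fun r => phi (ev r c)) ucvg).
  apply: (@continuous_comp _ _ _ (val c : R -> X) phi); last exact: cphi.
  exact: curve_continuous.
- by apply: aeW => c n _; rewrite lee_fin.
rewrite /Rintegral; apply: fine_cvg; rewrite fineK; first exact: H.
exact: (integrable_fin_num measurableT (ib 0%R)).
Qed.

(** The indicator of a cozero set is the limit of the truncated multiples of
    the function that defines it. *)
Lemma trace_continuous_open (U : set X) : open U ->
  trace_continuous pi (\1_U : borel X -> R).
Proof.
move=> oU; have [phi cphi UE] := open_cozero oU.
have cclamp : continuous (clamp : R -> R).
  move=> x; apply/cvgrPdist_lt => e e0; near=> y.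
  apply: le_lt_trans (clamp_lip _ _) _; near: y.
  by exact: (nbhsx_ballx x e).
(* Clamping also discards the negative values that [phi] may take off [U]. *)
pose psi n (x : X) := clamp (n%:R * phi x)%R.
have cpsi n : continuous (psi n).
  move=> x; apply: (@continuous_comp _ _ _ (fun x => n%:R * phi x)%R clamp); last exact: cclamp.
  by apply: cvgM; [exact: cvg_cst|exact: cphi].
have psi1 n x : (`|psi n x| <= 1)%R.
  by have /andP[h0 h1] := clamp_itv (n%:R * phi x)%R; rewrite ger0_norm.
apply: (@trace_continuous_dominated R X m pi tpi _ psi 1%R) => //.
- by apply: measurable_indic; exact: borel_open.
- by move=> n; apply: continuous_borel_real; exact: cpsi.
- by move=> n; apply: (@trace_continuous_bounded _ 1%R) => //; exact: cpsi.
- move=> x; rewrite indicE.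
  have [xU|xU] := boolP (x \in U).
    have phi0 : (0 < phi x)%R by move: xU; rewrite inE UE.
    apply: cvg_near_cst.
    near=> n; rewrite /psi /clamp min_r ?max_r//.
    by rewrite -ler_pdivrMr// div1r; near: n; exact: nbhs_infty_ger.
  have phi0 : (phi x <= 0)%R.
    by rewrite leNgt; apply: contra xU => ?; rewrite inE UE.
  have -> : psi ^~ x = fun=> 0%R.
    apply/funext => n; rewrite /psi /clamp max_l// ge_min.
    by rewrite mulr_ge0_le0.
  exact: cvg_cst.
Unshelve. all: by end_near. Qed.

Lemma integrable_indicT (A : set (borel X)) : measurable A ->
  m.-integrable setT (EFin \o (\1_A : borel X -> R)).
Proof.
move=> mA; apply: (@bounded_integrable _ (borel X) R m _ 1%R); first exact: measurable_indic.
by move=> x; rewrite indicE; case: (x \in A); rewrite ?normr1 ?normr0.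
Qed.

Lemma trace_continuous_sum (I : Type) (s : seq I) (F : I -> borel X -> R) :
  (forall i, m.-integrable setT (EFin \o F i)) -> (forall i, trace_continuous pi (F i)) ->
  m.-integrable setT (EFin \o (fun x => \sum_(i <- s) F i x)%R) /\
  trace_continuous pi (fun x => \sum_(i <- s) F i x)%R.
Proof.
move=> iF cF; elim: s => [|i s [IH1 IH2]].
  under [in X in X /\ _]eq_fun do rewrite big_nil.
  under [in X in _ /\ X]eq_fun do rewrite big_nil.
  split.
    by apply: (@bounded_integrable _ (borel X) R m _ 0%R) => // x; rewrite normr0.
  apply: (@trace_continuous_bounded _ 0%R); last by move=> x; rewrite normr0.
  by move=> x; exact: cvg_cst.
under [in X in X /\ _]eq_fun do rewrite big_cons.
under [in X in _ /\ X]eq_fun do rewrite big_cons.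
split; last exact: (trace_continuousD tpi (iF i) IH1 (cF i) IH2).
exact: integrable_EFinD.
Qed.

(** Open sets are stable under intersection and generate the Borel sets, so
    Dynkin's theorem applies. *)
Lemma trace_continuous_indic (A : set (borel X)) : measurable A ->
  trace_continuous pi (\1_A : borel X -> R).
Proof.
move: A.
apply: (@dynkin_induction _ (borel X) (@open X) (fun A => trace_continuous pi (\1_A : borel X -> R))) => //.
- by move=> A B; exact: openI.
- exact/trace_continuous_open/openT.
- by move=> A; exact: trace_continuous_open.
- move=> A mA cA.
  have -> : \1_(~` A) = (fun x => 1 + (-1) * \1_A x)%R :> (borel X -> R).
    apply/funext => x; rewrite !indicE in_setC; case: (x \in A) => /=.
      by rewrite mulr1 subrr.
    by rewrite mulr0 addr0.
  apply: (trace_continuousD tpi).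
  + by apply: (@bounded_integrable _ (borel X) R m _ 1%R) => // x; rewrite normr1.
  + exact/integrable_EFinZ/integrable_indicT.
  + apply: (@trace_continuous_bounded _ 1%R); last by move=> x; rewrite normr1.
    by move=> x; exact: cvg_cst.
  + by apply: (trace_continuousZ tpi) => //; exact: integrable_indicT.
- move=> F mF tF cF.
  pose psi n (x : borel X) := (\sum_(i <- iota 0 n) \1_(F i) x : R)%R.
  have psiE n x : psi n x = \1_(\bigcup_(i in [set i | (i < n)%N]) F i) x.
    rewrite /psi indicE; have [/[!inE]-[i /= ni Fix]|xF] := boolP (x \in _).
      rewrite (bigD1_seq i) ?mem_iota ?iota_uniq//= indicE mem_set// big1 ?addr0// => j ji.
      rewrite indicE memNset// => Fjx; move/eqP : ji; apply.
      by apply: (tF j i Logic.I Logic.I); exists x.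
    rewrite big_seq big1// => i; rewrite mem_iota/= add0n => ni.
    rewrite indicE memNset// => Fix; move/negP : xF; apply; rewrite inE.
    by exists i.
  have mpsi n : measurable_fun setT (psi n).
    rewrite (_ : psi n = \1_(\bigcup_(i in [set i | (i < n)%N]) F i)); last exact/funext.
    by apply: measurable_indic; apply: bigcup_measurable.
  apply: (@trace_continuous_dominated R X m pi tpi _ psi 1%R) => //.
  + by apply: measurable_indic; exact: bigcupT_measurable.
  + by move=> n x; rewrite psiE indicE; case: (x \in _); rewrite ?normr1 ?normr0.
  + move=> n; apply: (@trace_continuous_sum _ (iota 0 n) (fun i => \1_(F i) : borel X -> R) _ cF).2.
    by move=> i; exact: integrable_indicT.
  + move=> x; apply: cvg_near_cst.
    rewrite indicE; have [/[!inE]-[k _ Fkx]|xF] := boolP (x \in _).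
      near=> n; rewrite psiE indicE mem_set//; exists k => //=.
      by near: n; exact: nbhs_infty_gt.
    near=> n; rewrite psiE indicE memNset// => -[k _ Fkx].
    by move/negP : xF; apply; rewrite inE; exists k.
Unshelve. all: by end_near. Qed.

Import HBSimple.

(** Weak convergence of the marginals upgrades from continuous to integrable
    test functions because the marginals have uniformly bounded densities. *)
Lemma trace_continuous_integrable (phi : borel X -> R) :
  m.-integrable setT (EFin \o phi) -> trace_continuous pi phi.
Proof.
move=> iphi; have [g [ig _ g0]] := approximation_sfun_integrable measurableT iphi.
apply: (trace_continuous_L1 tpi iphi ig) => //.
move=> n.
have -> : (g n : borel X -> R) = (fun x => \sum_(y <- finmap.enum_fset (fset_set (range (g n)))) (y * \1_(g n @^-1` [set y]) x))%R.
  by apply/funext => x; rewrite fimfunE fsbig_finite.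
have mgy y : measurable (g n @^-1` [set y]) by exact: measurable_funPTI.
apply: (@trace_continuous_sum _ _ (fun y x => y * \1_(g n @^-1` [set y]) x)%R _ _).2.
  by move=> y; exact/integrable_EFinZ/integrable_indicT.
move=> y; apply: (trace_continuousZ tpi); first exact: integrable_indicT.
exact: trace_continuous_indic.
Qed.

End initial_trace_integrable.

(** * Difference quotients along a test plan *)

Section difference_quotient.
Context {R : realType} {X : completeMetricType R}.
Local Notation leb := (@lebesgue_measure R).

Lemma measurable_Et (t : R) : (0 <= t <= 1)%R ->
  measurable_fun setT (Et t : borel (AC2 X) -> R).
Proof.
move=> t01.
apply: (measurableT_comp (continuous_measurable_fun (@sqrt_continuous R))).
apply: measurable_funM => //.
apply: (measurableT_comp (fine_measurable measurableT)).
apply: (@measurable_time_integral R X (fun p => (metric_speed (val p.1) p.2 ^+ 2)%:E)) => //.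
- by apply/measurable_EFinP; apply: measurable_funX; exact: measurable_speed.
- by move=> p; rewrite lee_fin sqr_ge0.
Qed.

(** The ratio of the statement, with infinite values of [f] replaced by [0];
    these occur on a null set of curves only. *)
Definition quotient (f : X -> \bar R) (t : R) (c : AC2 X) : R :=
  (fine (f (ev 0%R c)) - fine (f (ev t c))) / Et t c.

Lemma measurable_quotient (f : X -> \bar R) (t : R) : (0 <= t <= 1)%R ->
  measurable_fun setT (f : borel X -> \bar R) ->
  measurable_fun setT (quotient f t : borel (AC2 X) -> R).
Proof.
move=> t01 mf; apply: measurable_funM.
  apply: measurable_funB; apply: (measurableT_comp (fine_measurable measurableT));
  exact: (measurableT_comp mf (measurable_ev _)).
rewrite (_ : (fun _ => _) = (fun c => Et t c `^ (-1))%R); last first.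
  by apply/funext => c; rewrite powR_inv1// Et_ge0.
apply: (measurableT_comp (measurable_powR (-1)%R)).
exact: measurable_Et.
Qed.

Variables (m : probability (borel X) R) (pi : probability (borel (AC2 X)) R).
Hypothesis tpi : test_plan m pi.

(** Where [Et t c] vanishes, so does the increment of [f]; hence the value [0]
    given to the ratio there is harmless and the increment can be recovered
    from it. *)
Lemma quotient_pointwise (f G : X -> \bar R) (b : X -> R) (N : set (borel X)) (t : R) :
  weak_upper_gradient m f G -> sq_representative m G b N -> (0 <= t <= 1)%R ->
  exists M : set (borel (AC2 X)), [/\ measurable M, pi M = 0 & forall c, ~ M c ->
    [/\ f (ev 0%R c) \is a fin_num, f (ev t c) \is a fin_num,
     (quotient f t c ^+ 2)%:E <= \int[leb]_(s in `[0%R, 1%R]) (b (ev (t * s) c) ^+ 2)%:E &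
     (fine (f (ev 0%R c)) - fine (f (ev t c)) = quotient f t c * Et t c)%R]].
Proof.
move=> fG bG t01.
have [M [mM M0 MP]] := ae_curve_restr tpi t01 (weak_upper_gradient_sqr fG bG).
exists M; split => // c /MP.
rewrite !ev_restr ?lexx ?ler01// mulr0 mulr1 => -[f0 ft].
have -> : \int[leb]_(s in `[0%R, 1%R]) (b (ev s (restr t c)) ^+ 2)%:E =
    \int[leb]_(s in `[0%R, 1%R]) (b (ev (t * s) c) ^+ 2)%:E.
  by apply: eq_integral => s /[!inE] s01; rewrite ev_restr.
have B0 : 0 <= \int[leb]_(s in `[0%R, 1%R]) (b (ev (t * s) c) ^+ 2)%:E.
  by apply: integral_ge0 => s _; rewrite lee_fin sqr_ge0.
move: (\int[leb]_(s in _) _) B0 => B B0.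
rewrite Et_restr// /quotient.
move: f0 ft; case: (f (ev 0%R c)) => [x||]//; case: (f (ev t c)) => [y||]// _ _.
rewrite -EFinB abse_EFin -EFin_expe real_normK ?num_real// => H.
(* If [Et t c = 0] the bound [H] has right-hand side [0], even if the average
   of the squared gradient is infinite. *)
have [E0|E0] := eqVneq (Et t c) 0%R.
  move: H; rewrite E0 expr0n mule0 lee_fin => xy.
  have -> : x = y.
    apply/esym/eqP; rewrite -subr_eq0 -sqrf_eq0 eq_le xy; exact: sqr_ge0.
  by split => //; rewrite /= subrr mul0r ?expr0n ?mul0r.
split => //; last by rewrite divfK.
case: B B0 H => [r r0 H|_ _|//]; last by rewrite leey.
move: H; rewrite -EFinM !lee_fin expr_div_n => H.
rewrite ler_pdivrMr; last by rewrite exprn_even_gt0.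
by rewrite -sqrrN opprB.
Qed.

Lemma quotient_sqr_le (f G : X -> \bar R) (b : X -> R) (N : set (borel X)) (t : R) :
  measurable_fun setT (f : borel X -> \bar R) ->
  weak_upper_gradient m f G -> sq_representative m G b N -> (0 <= t <= 1)%R ->
  \int[pi]_c (quotient f t c ^+ 2)%:E <=
  \int[leb]_(s in `[0%R, 1%R]) \int[pi]_c (b (ev (t * s) c) ^+ 2)%:E.
Proof.
move=> mf fG bG t01; have [[mb _] _ _ _ _] := bG.
have [M [mM M0 MP]] := quotient_pointwise fG bG t01.
pose F (p : borel (AC2 X) * R) := (b (ev (t * p.2) p.1) ^+ 2)%:E.
have mF : measurable_fun setT F.
  have mts : measurable_fun setT (fun p : borel (AC2 X) * R => (p.1, t * p.2)%R).
    apply: measurable_fun_pair; first exact: measurable_fst.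
    by apply: measurable_funM => //; exact: measurable_snd.
  apply/measurable_EFinP/measurable_funX; apply: (measurableT_comp mb).
  exact: (measurableT_comp measurable_eval mts).
have F0 p : 0 <= F p by rewrite lee_fin sqr_ge0.
rewrite -(@fubini_time R X pi F _ _ mF F0)//.
apply: ae_ge0_le_integral => //.
- by move=> c _; rewrite lee_fin sqr_ge0.
- by apply/measurable_EFinP/measurable_funX; exact: measurable_quotient.
- by move=> c _; apply: integral_ge0 => s _; exact: F0.
- exact: measurable_time_integral.
- by exists M; split => // c; apply: contra_notP => /MP[_ _ h _] _.
Qed.

(** The times [t * s] with [s] in [0,1] are all at most [t]. *)
Lemma average_initial_trace (b : borel X -> R) (d : R) :
  sq_integrable m b -> (0 < d)%R ->
  \forall t \near (0%R : R)^'+,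
  \int[leb]_(s in `[0%R, 1%R]) \int[pi]_c (b (ev (t * s) c) ^+ 2)%:E <=
  (\int[pi]_c (b (ev 0 c) ^+ 2) + d)%R%:E.
Proof.
move=> sb d0.
have ib := sq_integrable_sqr sb.
have tb := trace_continuous_integrable tpi ib.
set L := (\int[pi]_c (b (ev 0 c) ^+ 2))%R.
have : \forall r \near (0%R : R)^'+, (\int[pi]_c (b (ev r c) ^+ 2) <= L + d)%R.
  move/cvgrPdist_le : tb => /(_ _ d0); apply: filterS => r.
  by rewrite ler_norml => /andP[+ _]; rewrite -/L; lra.
move=> /nbhs_ballP[e /= e0 he].
near=> t.
have t0 : (0 <= t)%R by near: t; exact: nbhs_right_ge.
have te : (t < e)%R by near: t; exact: nbhs_right_lt.
have t1 : (t <= 1)%R by near: t; exact: nbhs_right_le.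
have key s : (0 <= s <= 1)%R -> \int[pi]_c (b (ev (t * s) c) ^+ 2)%:E <= (L + d)%R%:E.
  move=> /andP[s0 s1].
  have ts01 : (0 <= t * s <= 1)%R by rewrite mulr_ge0// mulr_ile1.
  rewrite -[leLHS]fineK; last first.
    exact: (integrable_fin_num measurableT (integrable_comp_ev tpi ts01 ib)).
  rewrite lee_fin; have [->|ts0] := eqVneq (t * s)%R 0%R.
    by rewrite -/L lerDl ltW.
  have : (0 < t * s)%R by rewrite lt_neqAle eq_sym ts0 mulr_ge0.
  move=> ts; apply: (he (t * s)%R); last exact: ts.
  rewrite /ball/= sub0r normrN gtr0_norm//.
  by apply: le_lt_trans te; rewrite ler_piMr.
apply: (@le_trans _ _ (\int[leb]_(s in `[0%R, 1%R]) (cst (L + d)%R%:E s))).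
  rewrite integral_mkcond [leRHS]integral_mkcond; apply: ge0_integral_homo => s.
    by rewrite patchE; case: ifPn => // _; apply: integral_ge0 => c _; rewrite lee_fin sqr_ge0.
  by rewrite !patchE; case: ifPn => // /[!inE]/=; rewrite in_itv/=; exact: key.
have l1 : leb `[0%R, 1%R]%classic = 1.
  by rewrite lebesgue_measure_itv/= lte_fin ltr01 oppr0 adde0.
rewrite (@integral_cst _ (measurableTypeR R))//.
by apply: (@le_trans _ _ ((L + d)%:E * 1)); [rewrite -l1|rewrite mule1].
Unshelve. all: by end_near. Qed.

End difference_quotient.

(** * Expansion of the square *)

Section polarization.
Context d (T : measurableType d) (R : realType) (P : {measure set T -> \bar R}).

(** The difference of the two sides is a sum of squares. Behind it:
    [- v e = - u v + v (u - e)], where [v (u - e)] is absorbed by Young's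
    inequality with parameter [eta]; [- u v] comes from [(u + eps v)^2]; and
    [u^2] is bounded below by [w^2], again by Young's inequality. *)
Lemma polarization_lower_bound (u v w e eps eta : R) : (0 < eps)%R -> (0 < eta)%R ->
  ((1 - eta) / (2 * eps) * w ^+ 2 <=
   - (v * e) + (1 / (2 * eps * eta) + 1 / (2 * eta)) * (u + (-1) * w) ^+ 2 +
   1 / (2 * eps) * (u + eps * v) ^+ 2 + eta * v ^+ 2 +
   1 / (2 * eta) * (e + (-1) * w) ^+ 2)%R.
Proof.
move=> eps0 eta0; rewrite -subr_ge0.
rewrite (_ : (_ - _ = (u - e + 2 * eta * v) ^+ 2 / (4 * eta) +
  (u + e - 2 * w) ^+ 2 / (4 * eta) + eps * v ^+ 2 / 2 +
  ((eta * w + u - w) ^+ 2 / eta + (u - w) ^+ 2) / (2 * eps))%R); last first.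
  by field; rewrite !gt_eqF.
have [e0 h0] := (ltW eps0, ltW eta0).
have sq (a b : R) : (0 <= b -> 0 <= a ^+ 2 / b)%R by move=> b0; rewrite divr_ge0// sqr_ge0.
apply: addr_ge0; [apply: addr_ge0; [apply: addr_ge0|]|].
- by apply: sq; rewrite mulr_ge0.
- by apply: sq; rewrite mulr_ge0.
- by rewrite divr_ge0// mulr_ge0// sqr_ge0.
- apply: divr_ge0; last by rewrite mulr_ge0.
  by rewrite addr_ge0 ?sq// sqr_ge0.
Qed.

Lemma integral_polarization (u v w e : T -> R) (eps eta : R) : (0 < eps)%R -> (0 < eta)%R ->
  sq_integrable P u -> sq_integrable P v -> sq_integrable P w -> sq_integrable P e ->
  ((1 - eta) / (2 * eps) * \int[P]_t (w t ^+ 2) <=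
   \int[P]_t (- (v t * e t)) +
   (1 / (2 * eps * eta) + 1 / (2 * eta)) * \int[P]_t ((u t + (-1) * w t) ^+ 2) +
   1 / (2 * eps) * \int[P]_t ((u t + eps * v t) ^+ 2) + eta * \int[P]_t (v t ^+ 2) +
   1 / (2 * eta) * \int[P]_t ((e t + (-1) * w t) ^+ 2))%R.
Proof.
move=> eps0 eta0 su sv sw se.
have ive : P.-integrable setT (EFin \o (fun t => - (v t * e t))%R).
  rewrite (_ : (fun _ => _) = (fun t => (-1) * (v t * e t))%R); last first.
    by apply/funext => t; rewrite mulN1r.
  exact/integrable_EFinZ/sq_integrableM.
have i1 := sq_integrable_sqr (sq_integrableD (-1)%R su sw).
have i2 := sq_integrable_sqr (sq_integrableD eps su sv).
have i3 := sq_integrable_sqr sv.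
have i4 := sq_integrable_sqr (sq_integrableD (-1)%R se sw).
have iw := sq_integrable_sqr sw.
have Z k (h : T -> R) (ih : P.-integrable setT (EFin \o h)) := integrable_EFinZ k ih.
have D (h1 h2 : T -> R) (ih1 : P.-integrable setT (EFin \o h1))
  (ih2 : P.-integrable setT (EFin \o h2)) := integrable_EFinD ih1 ih2.
have j1 := D _ _ ive (Z (1 / (2 * eps * eta) + 1 / (2 * eta))%R _ i1).
have j2 := D _ _ j1 (Z (1 / (2 * eps))%R _ i2).
have j3 := D _ _ j2 (Z eta _ i3).
have j4 := D _ _ j3 (Z (1 / (2 * eta))%R _ i4).
rewrite -(RintegralZl _ measurableT iw) -(RintegralZl _ measurableT i1).
rewrite -(RintegralZl _ measurableT i2) -(RintegralZl _ measurableT i3).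
rewrite -(RintegralZl _ measurableT i4).
rewrite -(RintegralD measurableT ive (Z _ _ i1)) -(RintegralD measurableT j1 (Z _ _ i2)).
rewrite -(RintegralD measurableT j2 (Z _ _ i3)) -(RintegralD measurableT j3 (Z _ _ i4)).
apply: le_Rintegral => //; first exact: Z.
by move=> t _; exact: polarization_lower_bound.
Qed.

(** The factor [v] stays bounded and multiplies only [u - e], which tends to
    [0] because [u] and [e] have the same limit [w]. *)
Lemma near_polarization (F : set_system R) {FF : Filter F} (u v e : R -> T -> R)
    (w : T -> R) (eps L K rho : R) : (0 < eps)%R -> (0 < rho)%R ->
  (\forall t \near F, [/\ sq_integrable P (u t), sq_integrable P (v t) & sq_integrable P (e t)]) ->
  sq_integrable P w ->
  (forall d, (0 < d)%R -> \forall t \near F,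
    \int[P]_x ((u t x + eps * v t x) ^+ 2)%:E <= (L + d)%R%:E) ->
  (\forall t \near F, \int[P]_x (v t x ^+ 2)%:E <= K%:E) ->
  (forall d, (0 < d)%R -> \forall t \near F,
    \int[P]_x ((u t x + (-1) * w x) ^+ 2)%:E <= d%:E) ->
  (forall d, (0 < d)%R -> \forall t \near F,
    \int[P]_x ((e t x + (-1) * w x) ^+ 2)%:E <= d%:E) ->
  \forall t \near F,
    ((\int[P]_x (w x ^+ 2) - L) / (2 * eps) - rho <= \int[P]_x (- (v t x * e t x)))%R.
Proof.
move=> eps0 rho0 suve sw HL HK H1 H2.
set W := (\int[P]_x (w x ^+ 2))%R.
have W0 : (0 <= W)%R by apply: Rintegral_ge0 => x _; exact: sqr_ge0.
(* The loss [rho] is split: [eta] makes the terms with factor [eta] at most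
   [rho / 4], the excess over [L] contributes [rho / 4], and each of the two
   distances to [w] contributes [rho / 8]. *)
pose Kp := (`|K| + W / (2 * eps) + 1)%R.
have Kp0 : (0 < Kp)%R by rewrite ltr_wpDl// addr_ge0// divr_ge0// mulr_ge0// ltW.
pose eta := (rho / (4 * Kp))%R.
have eta0 : (0 < eta)%R by rewrite divr_gt0// mulr_gt0.
pose c1 := (1 / (2 * eps * eta) + 1 / (2 * eta))%R.
have c20 : (0 < 1 / (2 * eta))%R by rewrite divr_gt0// mulr_gt0.
have c10 : (0 < c1)%R.
  by apply: addr_gt0 => //; apply: divr_gt0 => //; apply: mulr_gt0 => //; exact: mulr_gt0.
have d0 : (0 < rho * eps / 2)%R by rewrite divr_gt0// mulr_gt0.
have s1 : (0 < rho / 8 / c1)%R by rewrite !divr_gt0.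
have s2 : (0 < rho / 8 / (1 / (2 * eta)))%R by apply: divr_gt0 => //; exact: divr_gt0.
near=> t.
have [su sv se] : [/\ sq_integrable P (u t), sq_integrable P (v t) & sq_integrable P (e t)] by near: t.
have hL : (\int[P]_x ((u t x + eps * v t x) ^+ 2) <= L + rho * eps / 2)%R.
  by apply: ler_Rintegral_sqr; [exact: sq_integrableD|near: t; exact: HL].
have hK : (\int[P]_x (v t x ^+ 2) <= K)%R.
  by apply: ler_Rintegral_sqr => //; near: t; exact: HK.
have h1 : (\int[P]_x ((u t x + (-1) * w x) ^+ 2) <= rho / 8 / c1)%R.
  by apply: ler_Rintegral_sqr; [exact: sq_integrableD|near: t; exact: H1].
have h2 : (\int[P]_x ((e t x + (-1) * w x) ^+ 2) <= rho / 8 / (1 / (2 * eta)))%R.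
  by apply: ler_Rintegral_sqr; [exact: sq_integrableD|near: t; exact: H2].
have := integral_polarization eps0 eta0 su sv sw se.
rewrite -/W -/c1.
move: hL hK h1 h2.
move: (\int[P]_x ((u t x + eps * v t x) ^+ 2))%R (\int[P]_x (v t x ^+ 2))%R
  (\int[P]_x ((u t x + (-1) * w x) ^+ 2))%R (\int[P]_x ((e t x + (-1) * w x) ^+ 2))%R
  (\int[P]_x (- (v t x * e t x)))%R => I2 I3 I1 I4 I hL hK h1 h2.
have k1 : (c1 * I1 <= rho / 8)%R by rewrite mulrC -ler_pdivlMr.
have k2 : (1 / (2 * eta) * I4 <= rho / 8)%R by rewrite mulrC -ler_pdivlMr.
have k3 : (1 / (2 * eps) * I2 <= L / (2 * eps) + rho / 4)%R.
  rewrite mulrC mul1r ler_pdivrMr ?mulr_gt0//.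
  by rewrite mulrDl divfK ?gt_eqF ?mulr_gt0//; move: hL; lra.
have k4 : (eta * (I3 + W / (2 * eps)) <= rho / 4)%R.
  have : (I3 + W / (2 * eps) <= Kp)%R.
    rewrite /Kp; have := ler_norm K; move: hK; move: (W / (2 * eps))%R => z; lra.
  move=> h; apply: (@le_trans _ _ (eta * Kp)%R); first by rewrite ler_wpM2l// ltW.
  rewrite /eta; have Kn : Kp != 0%R by rewrite gt_eqF.
  by rewrite le_eqVlt; apply/orP; left; apply/eqP; field.
have k5 : ((1 - eta) / (2 * eps) * W = W / (2 * eps) - eta * (W / (2 * eps)))%R.
  by field; rewrite gt_eqF.
rewrite k5 (_ : (W - L) / (2 * eps) = W / (2 * eps) - L / (2 * eps))%R; last by rewrite mulrBl.
move: k1 k2 k3 k4; rewrite mulrDr.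
move: (c1 * I1)%R (1 / (2 * eta) * I4)%R (1 / (2 * eps) * I2)%R (eta * I3)%R (eta * (W / _))%R.
move: (W / _)%R (L / _)%R I.
by move=> a b c x y z k l; lra.
Unshelve. all: by end_near. Qed.

End polarization.

(** * Minimal weak upper gradients *)

Section weak_gradient_representatives.
Context {R : realType} {X : completeMetricType R}.
Variable m : probability (borel X) R.

Lemma wgrad_cases (f : X -> \bar R) :
  wgrad m f = cst +oo \/ minimal_weak_upper_gradient m f (wgrad m f).
Proof.
have [H|nf] := pselect (exists G, minimal_weak_upper_gradient m f G).
  by right; exact: (xgetPex (cst +oo) H).
by left; apply: xgetPN => G HG; apply: nf; exists G.
Qed.

(** The default value [+oo] has infinite norm, as [m] has mass [1]. *)
Lemma wgradP (f : X -> \bar R) : 'N[m]_2%:E[(wgrad m f : borel X -> \bar R)] < +oo ->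
  minimal_weak_upper_gradient m f (wgrad m f).
Proof.
have [->|//] := wgrad_cases f; apply: contraPP => _.
apply/negP; rewrite -leNgt leye_eq.
apply/eqP; apply: (@poweR_eqy _ _ 2%R); rewrite poweR_Lnorm//.
transitivity (\int[m]_(x in setT) cst +oo x).
  by apply: eq_integral => x _; apply: (@poweRyr _ 2%R); rewrite pnatr_eq0.
by rewrite integral_cst// [X in _ * X](@probability_setT _ _ _ m) mule1.
Qed.

Lemma wgrad_sq_representative (f : X -> \bar R) :
  'N[m]_2%:E[(wgrad m f : borel X -> \bar R)] < +oo ->
  weak_upper_gradient m f (wgrad m f) /\
  exists b N, sq_representative m (wgrad m f) b N.
Proof.
move=> foo; have [fG _] := wgradP foo; split => //.
by have [mG G0 _] := fG; exact: sq_representative_ex.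
Qed.

(** Applied to the minimal weak upper gradient of [g + eps f], which lies below
    the combination of those of [f] and [g] and is therefore square integrable. *)
Lemma sq_representative_le (G H : X -> \bar R) (b : X -> R) (N : set (borel X)) :
  m_measurable m G -> (forall x, 0 <= G x) ->
  {ae m, forall x : borel X, G x <= H x} -> sq_representative m H b N ->
  exists b' N', sq_representative m G b' N'.
Proof.
move=> mG G0 [M [mM M0 GM]] [[mb boo] b0 mN N0 Hb].
apply: sq_representative_ex => //.
have : 'N[m]_2%:E[(G : borel X -> \bar R)] ^+ 2 < +oo.
  rewrite Lnorm2_sqr; apply: le_lt_trans boo.
  have mNM : measurable (N `|` M) by exact: measurableU.
  have NM0 : m (N `|` M) = 0 by exact: null_set_setU.
  apply: (ge0_le_integral_off_null mNM NM0).
  - by apply/measurable_EFinP; exact: measurable_funX.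
  - by move=> x; rewrite mule_ge0.
  - by move=> x; rewrite lee_fin sqr_ge0.
  - move=> x /not_orP[Nx Mx]; rewrite EFin_expe -(Hb _ Nx) gee0_abs//.
    have GH : G x <= H x by apply: contrapT => h; apply: Mx; exact: GM.
    by rewrite lee_pmul.
by rewrite -poweR2 ?Lnorm_ge0//; apply: lty_poweRy.
Qed.

End weak_gradient_representatives.

(** * The first variation inequality *)

Section first_variation.
Context {R : realType} {X : completeMetricType R}.
Variables (m : probability (borel X) R) (pi : probability (borel (AC2 X)) R).
Hypothesis tpi : test_plan m pi.

Lemma test_plan_null (N : set (borel X)) (t : R) : (0 <= t <= 1)%R ->
  measurable N -> m N = 0 ->
  measurable (ev t @^-1` N : set (borel (AC2 X))) /\ pi (ev t @^-1` N) = 0.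
Proof.
move=> t01 mN N0; have [C C0 hC] := tpi; split.
  by have := @measurable_ev R X t measurableT N mN; rewrite setTI.
apply/eqP; rewrite eq_le measure_ge0 andbT.
by apply: le_trans (hC t t01 N mN) _; rewrite N0 mule0.
Qed.

Lemma near_Lnorm2_sqr d (T : measurableType d) (P : {measure set T -> \bar R})
    (F : R -> T -> \bar R) :
  'N[P]_2%:E[F t] @[t --> (0%R : R)^'+] --> 0 -> forall r, (0 < r)%R ->
  \forall t \near (0%R : R)^'+, \int[P]_x (`|F t x| ^+ 2) <= r%:E.
Proof.
move=> F0 r r0; near=> t; rewrite -Lnorm2_sqr.
have h : 'N[P]_2%:E[F t] <= (Num.sqrt r)%:E.
  apply: ltW; near: t; apply: (F0 [set y | y < (Num.sqrt r)%:E]).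
  apply: open_nbhs_nbhs; split; first exact: open_ereal_lt_ereal.
  by rewrite /= lte_fin sqrtr_gt0.
rewrite -(sqr_sqrtr (ltW r0)) EFin_expe.
by apply: lee_pmul => //; exact: Lnorm_ge0.
Unshelve. all: by end_near. Qed.

Lemma sq_integrable_ev (b : borel X -> R) (t : R) : (0 <= t <= 1)%R ->
  sq_integrable m b -> sq_integrable pi (fun c => b (ev t c)).
Proof.
move=> t01 sb; split; first by apply: measurable_comp_ev; case: sb.
have /integrableP[_ h] := integrable_comp_ev tpi t01 (sq_integrable_sqr sb).
apply: le_lt_trans h; apply: ge0_integral_homo => c; rewrite lee_fin ?sqr_ge0//.
exact: ler_norm.
Qed.

Lemma near_quotient_sqr (f G : X -> \bar R) (b : X -> R) (N : set (borel X)) (r : R) :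
  measurable_fun setT (f : borel X -> \bar R) ->
  weak_upper_gradient m f G -> sq_representative m G b N -> (0 < r)%R ->
  \forall t \near (0%R : R)^'+, \int[pi]_c (quotient f t c ^+ 2)%:E <=
    (\int[pi]_c (b (ev 0 c) ^+ 2) + r)%R%:E.
Proof.
move=> mf fG bG r0; have [sb _ _ _ _] := bG.
near=> t; apply: le_trans (quotient_sqr_le tpi mf fG bG _) _.
  by near: t; exact: near_right01.
by near: t; exact: (average_initial_trace tpi sb r0).
Unshelve. all: by end_near. Qed.

(** The expansion of the square for the quotients [u] of [g] and [v] of [f],
    with [e = Et t / t] and [w] the value of the gradient of [g] at the
    starting point; [u + eps v] is almost surely the quotient of
    [g + eps f]. *)
Lemma first_variation (f g Gf Gg Gh : X -> \bar R) (bf bg bh : X -> R)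
    (Nf Ng Nh : set (borel X)) (eps rho : R) :
  measurable_fun setT (f : borel X -> \bar R) ->
  measurable_fun setT (g : borel X -> \bar R) ->
  weak_upper_gradient m f Gf -> sq_representative m Gf bf Nf ->
  weak_upper_gradient m g Gg -> sq_representative m Gg bg Ng ->
  (0 < eps)%R -> weak_upper_gradient m (fun x => g x + eps%:E * f x) Gh ->
  sq_representative m Gh bh Nh ->
  'N[pi]_2%:E[(fun c : borel (AC2 X) =>
      (g (ev 0 c) - g (ev t c)) * ((Et t c)^-1)%:E - Gg (ev 0 c))]
    @[t --> (0%R : R)^'+] --> 0 ->
  'N[pi]_2%:E[(fun c : borel (AC2 X) => (Et t c / t)%:E - Gg (ev 0 c))]
    @[t --> (0%R : R)^'+] --> 0 ->
  (0 < rho)%R ->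
  \forall t \near (0%R : R)^'+,
   ((\int[pi]_c (bg (ev 0 c) ^+ 2) - \int[pi]_c (bh (ev 0 c) ^+ 2)) / (2 * eps) - rho)%R%:E
   <= \int[pi]_c ((f (ev t c) - f (ev 0 c)) * (t^-1)%:E).
Proof.
move=> mf mg wf rf wg rg eps0 wh rh H1 H2 rho0.
have [sbg _ mNg Ng0 Ggb] := rg.
have mh : measurable_fun setT ((fun x => g x + eps%:E * f x) : borel X -> \bar R).
  by apply: emeasurable_funD => //; apply: emeasurable_funM.
have i01 : (0 <= (0 : R) <= 1)%R by rewrite lexx ler01.
have [mN0 pN0] := test_plan_null i01 mNg Ng0.
have sw : sq_integrable pi (fun c => bg (ev 0%R c)) by exact: sq_integrable_ev.
pose u t (c : borel (AC2 X)) := quotient g t c.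
pose v t (c : borel (AC2 X)) := quotient f t c.
pose e t (c : borel (AC2 X)) := (Et t c / t)%R.
have me t : (0 <= t <= 1)%R -> measurable_fun setT (e t).
  by move=> t01; apply: measurable_funM => //; exact: measurable_Et.
have S1 r : (0 < r)%R -> \forall t \near (0%R : R)^'+,
    \int[pi]_c ((u t c + (-1) * bg (ev 0%R c)) ^+ 2)%:E <= r%:E.
  move=> r0; have h := near_Lnorm2_sqr H1 r0.
  near=> t; have t01 : (0 <= t <= 1)%R by near: t; exact: near_right01.
  apply: (@le_trans _ _ (\int[pi]_c (`|(g (ev 0 c) - g (ev t c)) * ((Et t c)^-1)%:E - Gg (ev 0 c)| ^+ 2))); last by near: t.
  have [M [mM M0 MP]] := quotient_pointwise tpi wg rg t01.
  have mMN : measurable (M `|` ev 0 @^-1` Ng) by exact: measurableU.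
  have MN0 : pi (M `|` ev 0 @^-1` Ng) = 0 by exact: null_set_setU.
  rewrite le_eqVlt; apply/orP; left; apply/eqP/esym.
  apply: (integral_off_null mMN MN0) => //.
    apply/measurable_EFinP/measurable_funX/measurable_funD; first exact: measurable_quotient.
    by apply: measurable_funM => //; case: sw.
  move=> c _ /not_orP[/MP[g0 gt _ _] Nc].
  rewrite (Ggb _ Nc) /u /quotient.
  move: g0 gt; case: (g (ev 0%R c)) => [x||]//; case: (g (ev t c)) => [y||]// _ _.
  rewrite -[`|_|]/((`|(x - y) / Et t c - bg (ev 0%R c)|%R)%:E) -EFin_expe real_normK ?num_real//.
  by rewrite mulN1r.
have S2 r : (0 < r)%R -> \forall t \near (0%R : R)^'+,
    \int[pi]_c ((e t c + (-1) * bg (ev 0%R c)) ^+ 2)%:E <= r%:E.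
  move=> r0; have h := near_Lnorm2_sqr H2 r0.
  near=> t; have t01 : (0 <= t <= 1)%R by near: t; exact: near_right01.
  apply: (@le_trans _ _ (\int[pi]_c (`|(Et t c / t)%:E - Gg (ev 0 c)| ^+ 2))); last by near: t.
  rewrite le_eqVlt; apply/orP; left; apply/eqP/esym.
  apply: (integral_off_null mN0 pN0) => //.
    apply/measurable_EFinP/measurable_funX/measurable_funD; first exact: me.
    by apply: measurable_funM => //; case: sw.
  move=> c _ Nc; rewrite (Ggb _ Nc) -EFinB abse_EFin -EFin_expe real_normK ?num_real//.
  by rewrite mulN1r.
have nf := near_quotient_sqr mf wf rf (@ltr01 R).
have ng := near_quotient_sqr mg wg rg (@ltr01 R).
have sq : \forall t \near (0%R : R)^'+, [/\ sq_integrable pi (u t), sq_integrable pi (v t) & sq_integrable pi (e t)].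
  near=> t; have t01 : (0 <= t <= 1)%R by near: t; exact: near_right01.
  split.
  - split; first exact: measurable_quotient.
    by apply: le_lt_trans (ltry _); near: t; exact: ng.
  - split; first exact: measurable_quotient.
    by apply: le_lt_trans (ltry _); near: t; exact: nf.
  - have sew : sq_integrable pi (fun c => e t c + (-1) * bg (ev 0%R c))%R.
      split; last by apply: le_lt_trans (ltry 1%R); near: t; exact: S2.
      by apply: measurable_funD; [exact: me|apply: measurable_funM => //; case: sw].
    have := sq_integrableD 1%R sew sw.
    by under [in X in sq_integrable _ X]eq_fun do rewrite mulN1r mul1r subrK.
have SL r : (0 < r)%R -> \forall t \near (0%R : R)^'+,
    \int[pi]_c ((u t c + eps * v t c) ^+ 2)%:E <= (\int[pi]_c (bh (ev 0 c) ^+ 2) + r)%R%:E.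
  move=> r0; have nh := near_quotient_sqr mh wh rh r0.
  near=> t; have t01 : (0 <= t <= 1)%R by near: t; exact: near_right01.
  apply: (@le_trans _ _ (\int[pi]_c (quotient (fun x => g x + eps%:E * f x)%E t c ^+ 2)%:E)); last by near: t; exact: nh.
  have [M [mM M0 MP]] := quotient_pointwise tpi wg rg t01.
  have [M' [mM' M'0 M'P]] := quotient_pointwise tpi wf rf t01.
  have mMN : measurable (M `|` M') by exact: measurableU.
  have MN0 : pi (M `|` M') = 0 by exact: null_set_setU.
  rewrite le_eqVlt; apply/orP; left; apply/eqP.
  apply: (integral_off_null mMN MN0) => //.
    by apply/measurable_EFinP/measurable_funX; exact: measurable_quotient.
  move=> c _ /not_orP[/MP[g0 gt _ _] /M'P[f0 ft _ _]].
  rewrite /u /v /quotient; move: g0 gt f0 ft.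
  case: (g (ev 0%R c)) => [x||]//; case: (g (ev t c)) => [y||]// _ _.
  case: (f (ev 0%R c)) => [z||]//; case: (f (ev t c)) => [w||]// _ _.
  rewrite -!EFinM -!EFinD [fine _]/= [fine _]/=; congr ((_ ^+ 2)%:E).
  by rewrite mulrA -mulrDl mulrBr opprD addrACA.
have := near_polarization eps0 rho0 sq sw SL nf S1 S2.
move=> H; near=> t.
have t01 : (0 <= t <= 1)%R by near: t; exact: near_right01.
have t0 : (0 < t)%R by near: t; exact: nbhs_right_gt.
have [su sv se] : [/\ sq_integrable pi (u t), sq_integrable pi (v t) & sq_integrable pi (e t)] by near: t.
have [M [mM M0 MP]] := quotient_pointwise tpi wf rf t01.
have ive : pi.-integrable setT (EFin \o (fun c => - (v t c * e t c))%R).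
  rewrite (_ : (fun _ => _) = (fun c => (-1) * (v t c * e t c))%R); last first.
    by apply/funext => c; rewrite mulN1r.
  exact/integrable_EFinZ/sq_integrableM.
rewrite (@integral_off_null _ _ _ pi _ (fun c => (- (v t c * e t c))%:E) M)//.
- rewrite -[leRHS]fineK; first by rewrite lee_fin; near: t; exact: H.
  exact: (integrable_fin_num measurableT ive).
- exact: (measurable_int pi ive).
- move=> c _ /MP[f0 ft _]; rewrite /v /e mulrA => <-.
  move: f0 ft; case: (f (ev 0%R c)) => [z||]//; case: (f (ev t c)) => [w||]// _ _.
  by rewrite -EFinB -EFinM /= -mulNr opprB.
Unshelve. all: by end_near. Qed.

End first_variation.

Unset Implicit Arguments.
Set Strict Implicit.

Theorem lemma4p5 (R : realType) (X : completeMetricType R)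
    (m : probability (borel X) R)
    (f g : X -> \bar R)
    (pi : probability (borel (AC2 X)) R) :
  separable X ->
  finite_second_moment m ->
  measurable_fun setT (f : borel X -> \bar R) ->
  measurable_fun setT (g : borel X -> \bar R) ->
  sobolev_ae_curve m f ->
  sobolev_ae_curve m g ->
  'N[m]_2%:E[(wgrad m f : borel X -> \bar R)] < +oo ->
  'N[m]_2%:E[(wgrad m g : borel X -> \bar R)] < +oo ->
  test_plan m pi ->
  'N[pi]_2%:E[(fun c : borel (AC2 X) =>
      (g (ev 0 c) - g (ev t c)) * ((Et t c)^-1)%:E - wgrad m g (ev 0 c))]
    @[t --> (0%R : R)^'+] --> 0 ->
  'N[pi]_2%:E[(fun c : borel (AC2 X) =>
      (Et t c / t)%:E - wgrad m g (ev 0 c))]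
    @[t --> (0%R : R)^'+] --> 0 ->
  limf_esup (fun eps : R =>
      \int[pi]_c (((wgrad m g (ev 0 c)) ^+ 2
                   - (wgrad m (fun x => g x + eps%:E * f x) (ev 0 c)) ^+ 2)
                  * ((2 * eps)^-1)%:E)) (0%R : R)^'+
  <= limf_einf (fun t : R =>
      \int[pi]_c ((f (ev t c) - f (ev 0 c)) * (t^-1)%:E)) (0%R : R)^'+.
Proof.
move=> _ _ mf mg _ _ foo goo tpi H1 H2.
have [wf [bf [Nf rf]]] := wgrad_sq_representative foo.
have [wg [bg [Ng rg]]] := wgrad_sq_representative goo.
have i01 : (0 <= (0 : R) <= 1)%R by rewrite lexx ler01.
set rhs := limf_einf _ _.
have variation_le (eps : R) : (0 < eps)%R ->
  \int[pi]_c (((wgrad m g (ev 0 c)) ^+ 2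
     - (wgrad m (fun x => g x + eps%:E * f x) (ev 0 c)) ^+ 2)
     * ((2 * eps)^-1)%:E) <= rhs.
  move=> eps0; have eps20 : (0 < (2 * eps)^-1)%R by rewrite invr_gt0 mulr_gt0.
  (* If the weak gradient is the default value, the integrand is [-oo]
     everywhere, also where the gradient of [g] is [+oo]. *)
  have [->|wh] := wgrad_cases m (fun x => g x + eps%:E * f x).
    rewrite (_ : \int[pi]_c _ = -oo) ?leNye//.
    transitivity (\int[pi]_(c in setT) cst -oo c).
      apply: eq_integral => c _.
      rewrite [X in _ - X]/= addeNy; exact: gt0_mulNye.
    by rewrite integral_cst// [X in _ * X](@probability_setT _ _ _ pi) mule1.
  have [wug hmin] := wh; have [mh h0 _] := wug.
  have hD := hmin _ (weak_upper_gradientD wf rf wg rg (ltW eps0)).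
  have [bh [Nh rh]] := sq_representative_le mh h0 hD (sq_representativeD rf rg (ltW eps0)).
  have [sg _ mNg Ng0 Ggb] := rg.
  have [sh _ mNh Nh0 Ghb] := rh.
  have ig := sq_integrable_sqr (sq_integrable_ev tpi i01 sg).
  have ih := sq_integrable_sqr (sq_integrable_ev tpi i01 sh).
  have igh : pi.-integrable setT (EFin \o (fun c : borel (AC2 X) =>
      (2 * eps)^-1 * (bg (ev 0 c) ^+ 2 + (-1) * bh (ev 0 c) ^+ 2))%R).
    exact/integrable_EFinZ/integrable_EFinD/integrable_EFinZ.
  have [mN pN] := test_plan_null tpi i01 mNg Ng0.
  have [mM pM] := test_plan_null tpi i01 mNh Nh0.
  have -> : \int[pi]_c (((wgrad m g (ev 0 c)) ^+ 2
     - (wgrad m (fun x => g x + eps%:E * f x) (ev 0 c)) ^+ 2)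
     * ((2 * eps)^-1)%:E) =
     ((\int[pi]_c (bg (ev 0 c) ^+ 2) - \int[pi]_c (bh (ev 0 c) ^+ 2)) / (2 * eps))%R%:E.
    rewrite (@integral_off_null _ _ _ pi _ (fun c => ((2 * eps)^-1 * (bg (ev 0 c) ^+ 2 + (-1) * bh (ev 0 c) ^+ 2))%R%:E) _ setT (measurableU _ _ mN mM))//; last 3 first.
    - exact: null_set_setU.
    - exact: (measurable_int pi igh).
    - move=> c _ /not_orP[Nc Mc]; rewrite (Ggb _ Nc) (Ghb _ Mc).
      by rewrite -!EFin_expe -EFinB -EFinM mulN1r mulrC.
    rewrite -[LHS]fineK; last exact: (integrable_fin_num measurableT igh).
    congr (_%:E); rewrite -/(Rintegral _ _ _).
    rewrite RintegralZl//; last exact/integrable_EFinD/integrable_EFinZ.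
    rewrite RintegralD//; last exact/integrable_EFinZ.
    by rewrite RintegralZl// mulN1r mulrC.
  apply/lee_addgt0Pr => rho rho0; rewrite -leeBlDr//.
  rewrite /rhs limf_einfE; apply: le_trans; last first.
    apply: ereal_sup_ubound; eexists; last by [].
    exact: (first_variation tpi mf mg wf rf wg rg eps0 wug rh H1 H2 rho0).
  by apply: le_ereal_inf_tmp => _ [t /= ht <-].
  (* The bound holds for every [eps > 0], so all positive reals serve as
     neighbourhood. *)
rewrite limf_esupE; apply: le_trans.
  by apply: ereal_inf_lbound; exists [set eps : R | (0 < eps)%R] => //; exact: nbhs_right_gt.
by apply: ge_ereal_sup => _ [eps eps0 <-]; exact: variation_le.
Qed.
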